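(* Let $p\geq 3$ be a prime, let $\phi(x)=\frac{ax+b}{cx+d}$ with $a,b,c,d\in\mathbb{Q}_p$, $ad-bc\ne0$, let $\Delta=(d-a)^2+4bc$ and assume $\sqrt{\Delta}\notin\mathbb{Q}_p$. Let $K=\mathbb{Q}_p(\sqrt{\Delta})$ and suppose that $\lambda=\frac{a+d+\sqrt{\Delta}}{a+d-\sqrt{\Delta}}\in K$ is not a root of unity. Let $\ell$ be the order of (the reduction of) $\lambda$ in the multiplicative group $\mathbb{K}^*$ of the residue field $\mathbb{K}$ of $K$. Suppose that $K$ is an unramified quadratic extension of $\mathbb{Q}_p$. Then $\ell\mid(p+1)$ and the dynamics $(\mathbb{P}^1(\mathbb{Q}_p),\phi)$ is decomposed into $$\frac{(p+1)\,p^{\,v_p(\lambda^{\ell}-1)-1}}{\ell}$$ minimal subsystems. The minimal subsystems are topologically conjugate to the adding machine on the odometer $\mathbb{Z}_{(p_s)}$ with $(p_s)=(\ell,\ell p,\ell p^2,\cdots)$.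
   Context: $\mathbb{P}^1(\mathbb{Q}_p)=\mathbb{Q}_p\cup\{\infty\}$ with its usual compact topology. $|\cdot|_p$ and $v_p=-\log_p|\cdot|_p$ are extended to $K$; one has $|\lambda|_p=1$. A subsystem is a pair $(E,\phi)$ with $E$ compact and $\phi(E)\subset E$; it is minimal if $E=\overline{\{\phi^n(x):n\ge 0\}}$ for every $x\in E$. ''Decomposed into $M$ minimal subsystems'' means that $\mathbb{P}^1(\mathbb{Q}_p)$ is the disjoint union of $M$ nonempty compact $\phi$-invariant sets, on each of which $\phi$ is minimal. For positive integers $p_s\mid p_{s+1}$ $(s\ge1)$, the odometer $\mathbb{Z}_{(p_s)}$ is the inverse limit of $\mathbb{Z}/p_s\mathbb{Z}$, and the adding machine is $x\mapsto x+1$ on it. *)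

(* Defs.v *)
From HB Require Import structures.
From mathcomp Require Import all_boot all_order all_algebra all_field.
From mathcomp Require Import all_classical all_reals all_analysis.
From mathcomp Require Import ring_quotient ring.

Set Implicit Arguments.
Unset Strict Implicit.
Unset Printing Implicit Defensive.

Import Order.TTheory GRing.Theory Num.Theory.
Import numFieldNormedType.Exports.
Local Open Scope classical_set_scope.
Local Open Scope quotient_scope.
Local Open Scope ring_scope.

Record absval (R : realFieldType) (F : fieldType) := AbsVal {
  absf :> F -> R;
  absf_ge0 : forall x, 0 <= absf x;
  absf_eq0 : forall x, (absf x == 0) = (x == 0);
  absfM : forall x y, absf (x * y) = absf x * absf y;
  absfD : forall x y, absf (x + y) <= Num.max (absf x) (absf y)
}.

Section AbsvalTheory.
Variables (R : realFieldType) (F : fieldType) (v : absval R F).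
Implicit Types x y : F.

Lemma absf0 : v 0 = 0. Proof. by apply/eqP; rewrite absf_eq0. Qed.

Lemma absf_gt0 x : (0 < v x) = (x != 0).
Proof. by rewrite lt_neqAle absf_ge0 andbT eq_sym absf_eq0. Qed.

Lemma absf1 : v 1 = 1.
Proof.
have h : v 1 != 0 by rewrite absf_eq0 oner_eq0.
by apply: (mulfI h); rewrite -absfM !mulr1.
Qed.

Lemma absfN x : v (- x) = v x.
Proof.
have h : v (-1) = 1.
  have := absfM v (-1) (-1); rewrite mulrNN mulr1 absf1 => /esym/eqP.
  rewrite -expr2 sqrf_eq1 => /orP[/eqP//|/eqP h].
  by have := absf_ge0 v (-1); rewrite h oppr_ge0 ler10.
by rewrite -mulN1r absfM h mul1r.
Qed.

Lemma absfB x y : v (x - y) <= Num.max (v x) (v y).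
Proof. by rewrite -(absfN y) absfD. Qed.

Lemma absfBC x y : v (x - y) = v (y - x).
Proof. by rewrite -absfN opprB. Qed.

Lemma absfV x : v x^-1 = (v x)^-1.
Proof.
have [->|x0] := eqVneq x 0; first by rewrite invr0 absf0 invr0.
have h : v x != 0 by rewrite absf_eq0.
by apply: (mulfI h); rewrite -absfM !divff ?absf1.
Qed.

Lemma absf_eqr x y : v (x - y) < v y -> v x = v y.
Proof.
move=> h; apply/eqP; rewrite eq_le; apply/andP; split.
  rewrite -{1}(subrK y x); apply: (le_trans (absfD _ _ _)).
  by rewrite ge_max lexx (ltW h).
rewrite leNgt; apply/negP => hxy.
have : v y <= Num.max (v (y - x)) (v x) by rewrite -{1}(subrK x y) absfD.
by rewrite le_max !leNgt absfBC h hxy.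
Qed.

End AbsvalTheory.

Section Completion.
Variables (R : realFieldType) (F : fieldType) (v : absval R F).
Implicit Types u w : nat -> F.

Definition cauchy_seq u := forall e : R, 0 < e ->
  exists N, forall m n, (N <= m)%N -> (N <= n)%N -> v (u m - u n) < e.

Definition null_seq u := forall e : R, 0 < e ->
  exists N, forall n, (N <= n)%N -> v (u n) < e.

Definition cauchy_pred : {pred nat -> F} := [pred u | `[< cauchy_seq u >]].

Lemma cauchy_predP u : reflect (cauchy_seq u) (u \in cauchy_pred).
Proof. exact: asboolP. Qed.

Lemma cauchy_seq_bounded u : cauchy_seq u ->
  exists M N, 0 < M /\ forall n, (N <= n)%N -> v (u n) <= M.
Proof.
move=> /(_ 1 ltr01)[N hN].
exists (Num.max 1 (v (u N))), N; split; first by rewrite lt_max ltr01.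
move=> n Nn; rewrite -(subrK (u N) (u n)).
apply: (le_trans (absfD _ _ _)); rewrite ge_max !le_max lexx orbT andbT.
by rewrite (ltW (hN n N Nn (leqnn N))).
Qed.

Lemma cauchy_seq_eventually u : cauchy_seq u -> ~ null_seq u ->
  exists2 r, 0 < r & exists N, forall n, (N <= n)%N -> v (u n) = r.
Proof.
move=> cu /existsNP[e] /not_implyP[e0] /forallNP nu.
have [N hN] := cu e e0.
have /existsNP[n /not_implyP[Nn /negP]] := nu N.
rewrite -leNgt => en; exists (v (u n)); first exact: lt_le_trans en.
by exists N => m Nm; apply: absf_eqr; apply: lt_le_trans en; apply: hN.
Qed.

Lemma null_cauchy_seq u : null_seq u -> cauchy_seq u.
Proof.
move=> nu e e0; have [N hN] := nu e e0; exists N => m n Nm Nn.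
by apply: (le_lt_trans (absfB _ _ _)); rewrite gt_max !hN.
Qed.

Lemma null_seqM u w : cauchy_seq u -> null_seq w -> null_seq (u * w).
Proof.
move=> /cauchy_seq_bounded[M [N [M0 hN]]] nw e e0.
have [N' hN'] := nw (e / M) (divr_gt0 e0 M0).
exists (maxn N N') => n; rewrite geq_max => /andP[h h'].
rewrite [(u * w) n]/(u n * w n) absfM.
apply: (@le_lt_trans _ _ (M * v (w n))).
  by rewrite ler_wpM2r ?absf_ge0 ?hN.
by rewrite mulrC -ltr_pdivlMr ?hN'.
Qed.

Lemma cauchy_subring_closed : subring_closed cauchy_pred.
Proof.
split.
- apply/cauchy_predP => e e0; exists 0%N => m n _ _.
  by rewrite [X in v X](_ : _ = 0) ?absf0 //; exact: subrr.
- move=> u w /cauchy_predP cu /cauchy_predP cw; apply/cauchy_predP => e e0.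
  have [N hN] := cu e e0; have [N' hN'] := cw e e0.
  exists (maxn N N') => m n; rewrite !geq_max => /andP[h1 h2] /andP[h3 h4].
  rewrite [X in v X](_ : _ = (u m - u n) - (w m - w n)); last first.
    by transitivity (u m - w m - (u n - w n)) => //; ring.
  by apply: (le_lt_trans (absfB _ _ _)); rewrite gt_max hN ?hN'.
- move=> u w /cauchy_predP cu /cauchy_predP cw; apply/cauchy_predP => e e0.
  have [M [N [M0 hM]]] := cauchy_seq_bounded cu.
  have [M' [N' [M0' hM']]] := cauchy_seq_bounded cw.
  have [N1 hN1] := cu _ (divr_gt0 e0 M0').
  have [N2 hN2] := cw _ (divr_gt0 e0 M0).
  exists (maxn (maxn N N') (maxn N1 N2)) => m n.
  rewrite !geq_max => /andP[/andP[a1 a2] /andP[a3 a4]].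
  move=> /andP[/andP[b1 b2] /andP[b3 b4]].
  rewrite [X in v X](_ : _ = u m * (w m - w n) + (u m - u n) * w n); last first.
    by transitivity (u m * w m - u n * w n) => //; ring.
  apply: (le_lt_trans (absfD _ _ _)); rewrite gt_max !absfM; apply/andP; split.
    apply: (@le_lt_trans _ _ (M * v (w m - w n))).
      by rewrite ler_wpM2r ?absf_ge0 ?hM.
    by rewrite mulrC -ltr_pdivlMr ?hN2.
  apply: (@le_lt_trans _ _ (v (u m - u n) * M')).
    by rewrite ler_wpM2l ?absf_ge0 ?hM'.
  by rewrite -ltr_pdivlMr ?hN1.
Qed.

HB.instance Definition _ :=
  GRing.isSubringClosed.Build (nat -> F) cauchy_pred cauchy_subring_closed.

Record cauchyType := CauchySeq {
  cauchy_val :> nat -> F;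
  cauchy_valP : cauchy_val \in cauchy_pred }.

HB.instance Definition _ := [isSub for cauchy_val].
HB.instance Definition _ := [Choice of cauchyType by <:].
HB.instance Definition _ := [SubChoice_isSubComNzRing of cauchyType by <:].

Lemma cauchyP (u : cauchyType) : cauchy_seq u.
Proof. exact/cauchy_predP/cauchy_valP. Qed.

Definition null_pred : {pred cauchyType} := [pred u : cauchyType | `[< null_seq u >]].

Lemma null_predP (u : cauchyType) : reflect (null_seq u) (u \in null_pred).
Proof. exact: asboolP. Qed.

Lemma null_idealr_closed : idealr_closed null_pred.
Proof.
split.
- by apply/null_predP => e e0; exists 0%N => n _; rewrite absf0.
- apply/null_predP => /(_ 1 ltr01)[N /(_ N (leqnn N))].
  by rewrite [X in v X](_ : _ = 1) // absf1 ltxx.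
- move=> a u w /null_predP nu /null_predP nw; apply/null_predP.
  have nau : null_seq (a * u) by apply: null_seqM => //; exact: cauchyP.
  move=> e e0; have [N hN] := nau e e0; have [N' hN'] := nw e e0.
  exists (maxn N N') => n; rewrite geq_max => /andP[h h'].
  by apply: (le_lt_trans (absfD _ _ _)); rewrite gt_max hN' ?hN.
Qed.

HB.instance Definition _ :=
  isIdealr.Build cauchyType null_pred null_idealr_closed.

Definition null_ideal : idealr cauchyType := null_pred.

Definition completion := {ideal_quot null_ideal}.

HB.instance Definition _ := GRing.ComNzRing.on completion.

Lemma completion_pi_eq (u w : cauchyType) :
  (\pi_completion u == \pi_completion w) = (u - w \in null_pred).
Proof. exact: esym (Quotient.idealrBE null_ideal u w). Qed.

Lemma completion_eq0 (x : completion) :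
  (x == 0) = (repr x \in null_pred).
Proof.
by rewrite -[x in LHS]reprK -(rmorph0 \pi_completion) completion_pi_eq subr0.
Qed.

Lemma completion_mulVex (x : completion) : x != 0 -> exists y, y * x = 1.
Proof.
rewrite completion_eq0 => /null_predP nx.
have [r r0 [N hN]] := cauchy_seq_eventually (cauchyP (repr x)) nx.
pose w n := (repr x n)^-1.
have cw : w \in cauchy_pred.
  apply/cauchy_predP => e e0.
  have [N' hN'] := cauchyP (repr x) (mulr_gt0 e0 (mulr_gt0 r0 r0)).
  exists (maxn N N') => m n; rewrite !geq_max => /andP[a1 a2] /andP[b1 b2].
  have um : repr x m != 0 by rewrite -(absf_eq0 v) hN // gt_eqF.
  have un : repr x n != 0 by rewrite -(absf_eq0 v) hN // gt_eqF.
  rewrite (_ : _ - _ = (repr x n - repr x m) / (repr x m * repr x n)).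
    rewrite absfM absfV absfM !hN // ltr_pdivrMr ?mulr_gt0 //.
    exact: hN'.
  by rewrite /w; field; rewrite um un.
exists (\pi_completion (CauchySeq cw)).
rewrite -[x in X in X = _]reprK -rmorphM -(rmorph1 \pi_completion).
apply/eqP; rewrite completion_pi_eq; apply/null_predP => e e0.
exists N => n Nn; rewrite [X in v X](_ : _ = 0) ?absf0 //.
have un : repr x n != 0 by rewrite -(absf_eq0 v) hN // gt_eqF.
by apply/eqP; rewrite subr_eq0; apply/eqP; exact: mulVf.
Qed.

Definition completion_inv (x : completion) : completion :=
  if x == 0 then 0 else xget 0 [set y | y * x = 1].

Lemma completion_mulVf (x : completion) : x != 0 -> completion_inv x * x = 1.
Proof.
move=> x0; rewrite /completion_inv (negbTE x0).
by have [y yx] := completion_mulVex x0; exact: (@xgetPex _ 0 [set z | z * x = 1] (ex_intro _ y yx)).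
Qed.

Lemma completion_inv0 : completion_inv 0 = 0.
Proof. by rewrite /completion_inv eqxx. Qed.

HB.instance Definition _ :=
  GRing.ComNzRing_isField.Build completion completion_mulVf completion_inv0.

Definition completion_absf (x : completion) : R :=
  lim (v (cauchy_val (repr x) n) @[n --> \oo]).

Lemma completion_absf_null (x : completion) : x = 0 -> completion_absf x = 0.
Proof.
move=> /eqP; rewrite completion_eq0 => /null_predP nx.
apply/cvg_lim => //; apply/cvgrPdist_lt => e e0.
have [N hN] := nx e e0; exists N => // n /= Nn.
by rewrite sub0r normrN ger0_norm ?absf_ge0 ?hN.
Qed.

Lemma completion_absf_pi (u : cauchyType) (r : R) : 0 < r ->
  (exists N, forall n, (N <= n)%N -> v (u n) = r) ->
  completion_absf (\pi_completion u) = r.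
Proof.
move=> r0 [N hN].
have : \pi_completion (repr (\pi_completion u)) == \pi_completion u.
  by rewrite reprK.
rewrite completion_pi_eq => /null_predP/(_ r r0)[N' hN'].
apply/cvg_lim => //; apply: cvg_near_cst; exists (maxn N N') => // n /=.
rewrite geq_max => /andP[h h'].
by rewrite -(hN n h); apply: absf_eqr; rewrite (hN n h); exact: hN'.
Qed.

Lemma completion_absf_repr (x : completion) : x != 0 ->
  0 < completion_absf x /\
  exists N, forall n, (N <= n)%N -> v (repr x n) = completion_absf x.
Proof.
rewrite completion_eq0 => /null_predP nx.
have [r r0 hr] := cauchy_seq_eventually (cauchyP (repr x)) nx.
by have := completion_absf_pi r0 hr; rewrite reprK => ->.
Qed.

Lemma completion_absf_ge0 x : 0 <= completion_absf x.
Proof.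
have [x0|/completion_absf_repr[/ltW//]] := eqVneq x 0.
by rewrite completion_absf_null.
Qed.

Lemma completion_absf_eq0 x : (completion_absf x == 0) = (x == 0).
Proof.
have [x0|/completion_absf_repr[h _]] := eqVneq x 0.
  by rewrite completion_absf_null ?eqxx.
by rewrite gt_eqF.
Qed.

Lemma completion_absfM x y :
  completion_absf (x * y) = completion_absf x * completion_absf y.
Proof.
have [->|x0] := eqVneq x 0.
  by rewrite mul0r (@completion_absf_null 0) // mul0r.
have [->|y0] := eqVneq y 0.
  by rewrite mulr0 (@completion_absf_null 0) // mulr0.
have [hx [N hN]] := completion_absf_repr x0.
have [hy [N' hN']] := completion_absf_repr y0.
rewrite -[x in LHS]reprK -[y in LHS]reprK -rmorphM.
apply: completion_absf_pi; first exact: mulr_gt0.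
exists (maxn N N') => n; rewrite geq_max => /andP[h h'].
by rewrite -(hN n h) -(hN' n h') -absfM.
Qed.

Lemma completion_absfD x y :
  completion_absf (x + y) <= Num.max (completion_absf x) (completion_absf y).
Proof.
have [->|x0] := eqVneq x 0; first by rewrite add0r le_max lexx orbT.
have [->|y0] := eqVneq y 0; first by rewrite addr0 le_max lexx.
have [xy|xy0] := eqVneq (x + y) 0.
  by rewrite completion_absf_null // le_max completion_absf_ge0.
have [hx [N hN]] := completion_absf_repr x0.
have [hy [N' hN']] := completion_absf_repr y0.
have := xy0; rewrite -[x]reprK -[y]reprK -rmorphD.
rewrite -(rmorph0 \pi_completion) completion_pi_eq subr0 => /null_predP nxy.
have [r r0 [M hM]] := cauchy_seq_eventually (cauchyP (repr x + repr y)) nxy.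
rewrite (completion_absf_pi r0); last by exists M.
rewrite !reprK; move: (completion_absf x) (completion_absf y) {hx hy} hN hN'.
move=> X Y hN hN'; pose n := maxn M (maxn N N').
have hn : (M <= n)%N by exact: leq_maxl.
have hn1 : (N <= n)%N by rewrite (leq_trans (leq_maxl N N')) ?leq_maxr.
have hn2 : (N' <= n)%N by rewrite (leq_trans (leq_maxr N N')) ?leq_maxr.
by rewrite -(hM n hn) -(hN n hn1) -(hN' n hn2); exact: absfD.
Qed.

Definition completion_abs : absval R completion :=
  AbsVal completion_absf_ge0 completion_absf_eq0 completion_absfM
    completion_absfD.

Definition completion_ball (x : completion) (e : R) (y : completion) : Prop :=
  completion_abs (x - y) < e.

Lemma completion_ball_center x (e : R) : 0 < e -> completion_ball x e x.
Proof. by rewrite /completion_ball subrr absf0. Qed.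

Lemma completion_ball_sym x y (e : R) :
  completion_ball x e y -> completion_ball y e x.
Proof. by rewrite /completion_ball absfBC. Qed.

Lemma completion_ball_triangle x y z (e1 e2 : R) :
  completion_ball x e1 y -> completion_ball y e2 z ->
  completion_ball x (e1 + e2) z.
Proof.
rewrite /completion_ball => h1 h2.
have e10 : 0 < e1 by apply: le_lt_trans h1; exact: absf_ge0.
have e20 : 0 < e2 by apply: le_lt_trans h2; exact: absf_ge0.
rewrite -(subrK y x) -addrA; apply: (le_lt_trans (absfD _ _ _)).
by rewrite gt_max (lt_trans h1) ?ltrDl // (lt_trans h2) ?ltrDr.
Qed.

HB.instance Definition _ := hasNbhs.Build completion
  (nbhs_ (entourage_ completion_ball)).
HB.instance Definition _ := Nbhs_isPseudoMetric.Build R completion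
  erefl completion_ball_center completion_ball_sym completion_ball_triangle
  erefl.

End Completion.

Section Padic.
Variables (p : nat) (pr_p : prime p).

Definition padic_absz (m : int) : rat :=
  if m == 0 then 0 else (p%:R ^+ logn p `|m|%N)^-1.

Let p_gt0 n : 0 < (p%:R ^+ n : rat).
Proof. by rewrite exprn_gt0 // ltr0n prime_gt0. Qed.

Lemma padic_absz_ge0 m : 0 <= padic_absz m.
Proof. by rewrite /padic_absz; case: ifP => // _; rewrite invr_ge0 ltW. Qed.

Lemma padic_absz_eq0 m : (padic_absz m == 0) = (m == 0).
Proof.
by rewrite /padic_absz; have [//|_] := eqVneq m 0; rewrite gt_eqF ?invr_gt0.
Qed.

Lemma padic_abszM m n : padic_absz (m * n) = padic_absz m * padic_absz n.
Proof.
rewrite /padic_absz mulf_eq0.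
have [//|m0] := eqVneq m 0; first by rewrite mul0r.
have [//|n0] := eqVneq n 0; first by rewrite mulr0.
by rewrite /= abszM lognM ?absz_gt0 // exprD invfM.
Qed.

Lemma padic_abszD m n :
  padic_absz (m + n) <= Num.max (padic_absz m) (padic_absz n).
Proof.
have [->|m0] := eqVneq m 0; first by rewrite add0r le_max lexx orbT.
have [->|n0] := eqVneq n 0; first by rewrite addr0 le_max lexx.
have [->|mn0] := eqVneq (m + n) 0.
  by rewrite /padic_absz eqxx le_max padic_absz_ge0.
rewrite /padic_absz (negbTE m0) (negbTE n0) (negbTE mn0) le_max !lef_pV2 ?posrE //.
have pp : 1 < p%:R :> rat by rewrite ltr1n prime_gt1.
rewrite !ler_eXn2l // -geq_min -pfactor_dvdn ?absz_gt0 //.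
have dv k : k != 0 -> forall i, (i <= logn p `|k|)%N ->
    ((p ^ i)%:Z %| k)%Z.
  by move=> k0 i hi; rewrite dvdzE absz_nat pfactor_dvdn ?absz_gt0.
have : ((p ^ minn (logn p `|m|) (logn p `|n|))%:Z %| m + n)%Z.
  by rewrite rpredD ?dv ?geq_minl ?geq_minr.
by rewrite dvdzE absz_nat.
Qed.

Definition padic_absq (q : rat) : rat :=
  padic_absz (numq q) / padic_absz (denq q).

Lemma padic_absq_frac m n : n != 0 ->
  padic_absq (m%:~R / n%:~R) = padic_absz m / padic_absz n.
Proof.
move=> n0; rewrite /padic_absq.
set q : rat := m%:~R / n%:~R.
have d0 : padic_absz (denq q) != 0 by rewrite padic_absz_eq0 denq_neq0.
have n0' : padic_absz n != 0 by rewrite padic_absz_eq0.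
apply/eqP; rewrite eqr_div // -!padic_abszM; apply/eqP; congr padic_absz.
have n1 : n%:~R != 0 :> rat by rewrite intr_eq0.
have d1 : (denq q)%:~R != 0 :> rat by rewrite intr_eq0 denq_neq0.
apply: (@intr_inj rat); rewrite !intrM; apply/eqP.
by rewrite -eqr_div // divq_num_den.
Qed.

Lemma padic_absq_ge0 q : 0 <= padic_absq q.
Proof. by rewrite divr_ge0 ?padic_absz_ge0. Qed.

Lemma padic_absq_eq0 q : (padic_absq q == 0) = (q == 0).
Proof.
by rewrite mulf_eq0 invr_eq0 !padic_absz_eq0 numq_eq0 (negbTE (denq_neq0 _)) orbF.
Qed.

Lemma padic_absqM q r : padic_absq (q * r) = padic_absq q * padic_absq r.
Proof.
rewrite -[q in LHS]divq_num_den -[r in LHS]divq_num_den mulf_div -!intrM.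
by rewrite padic_absq_frac ?mulf_neq0 ?denq_neq0 // !padic_abszM -mulf_div.
Qed.

Lemma padic_absqD q r :
  padic_absq (q + r) <= Num.max (padic_absq q) (padic_absq r).
Proof.
have d1 : (denq q)%:~R != 0 :> rat by rewrite intr_eq0 denq_neq0.
have d2 : (denq r)%:~R != 0 :> rat by rewrite intr_eq0 denq_neq0.
have d12 : denq q * denq r != 0 by rewrite mulf_neq0 ?denq_neq0.
have a12 : 0 < padic_absz (denq q * denq r).
  by rewrite lt_neqAle eq_sym padic_absz_eq0 d12 padic_absz_ge0.
have key (s : rat) (m : int) : s = m%:~R / (denq q * denq r)%:~R ->
    padic_absq s = padic_absz m / padic_absz (denq q * denq r).
  by move=> ->; rewrite padic_absq_frac.
rewrite (key q (numq q * denq r)); last first.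
  by rewrite !intrM -mulf_div divff // mulr1 divq_num_den.
rewrite (key r (numq r * denq q)); last first.
  by rewrite !intrM [(denq q)%:~R * _]mulrC -mulf_div divff // mulr1 divq_num_den.
rewrite (key _ (numq q * denq r + numq r * denq q)); last first.
  by rewrite -[q in LHS]divq_num_den -[r in LHS]divq_num_den addf_div //
     intrD !intrM.
by rewrite -maxr_pMl ?invr_ge0 ?(ltW a12) // ler_pM2r ?invr_gt0 // padic_abszD.
Qed.

Definition rat_padic_abs : absval rat rat :=
  AbsVal padic_absq_ge0 padic_absq_eq0 padic_absqM padic_absqD.

End Padic.

(* The absolute value of [Qp] takes its values in p^Z and 0, so it is
   [rat]-valued; it is sent to the reals with [ratr] when needed. *)
Notation Qp pr_p := (completion (rat_padic_abs pr_p)).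
Notation Qp_abs pr_p := (completion_abs (rat_padic_abs pr_p)).

Section ResidueField.
Variables (R : realFieldType) (F : fieldType) (v : absval R F).

Definition valring_pred : {pred F} := [pred x | v x <= 1].

Lemma valring_subring_closed : subring_closed valring_pred.
Proof.
split=> [|x y|x y]; rewrite ?inE ?absf1 //= => hx hy.
  by apply: (le_trans (absfB _ _ _)); rewrite ge_max hx.
by rewrite absfM mulr_ile1 ?absf_ge0.
Qed.

HB.instance Definition _ :=
  GRing.isSubringClosed.Build F valring_pred valring_subring_closed.

Record valring := ValRing {
  valring_val :> F;
  valring_valP : valring_val \in valring_pred }.

HB.instance Definition _ := [isSub for valring_val].
HB.instance Definition _ := [Choice of valring by <:].
HB.instance Definition _ := [SubChoice_isSubComNzRing of valring by <:].

Definition maxideal_pred : {pred valring} := [pred x : valring | v (val x) < 1].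

Lemma maxideal_idealr_closed : idealr_closed maxideal_pred.
Proof.
split; rewrite ?inE /= ?absf0 ?absf1 ?ltr01 ?ltxx //.
move=> a x y; rewrite !inE /= => hx hy.
apply: (le_lt_trans (absfD _ _ _)); rewrite gt_max hy andbT absfM.
apply: le_lt_trans hx; rewrite ler_piMl ?absf_ge0 //.
exact: (valring_valP a).
Qed.

HB.instance Definition _ :=
  isIdealr.Build valring maxideal_pred maxideal_idealr_closed.

Definition maxideal : idealr valring := maxideal_pred.

Definition residue := {ideal_quot maxideal}.

HB.instance Definition _ := GRing.ComNzRing.on residue.

Lemma residue_mulVex (x : residue) : x != 0 -> exists y, y * x = 1.
Proof.
rewrite -[x]reprK -(rmorph0 \pi_residue) -(Quotient.idealrBE maxideal) subr0.
set z := repr x; rewrite inE /= -leNgt => hz.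
have z1 : v (val z) = 1 by apply: le_anti; rewrite hz andbT; exact: valring_valP.
have z0 : val z != 0 by rewrite -(absf_eq0 v) z1 oner_eq0.
have hV : (val z)^-1 \in valring_pred by rewrite inE /= absfV z1 invr1.
exists (\pi_residue (ValRing hV)); rewrite -rmorphM -(rmorph1 \pi_residue).
by congr (\pi_residue _); apply/val_inj; rewrite /= mulVf.
Qed.

Definition residue_inv (x : residue) : residue :=
  if x == 0 then 0 else xget 0 [set y | y * x = 1].

Lemma residue_mulVf (x : residue) : x != 0 -> residue_inv x * x = 1.
Proof.
move=> x0; rewrite /residue_inv (negbTE x0).
by have [y yx] := residue_mulVex x0; exact: (@xgetPex _ 0 [set z | z * x = 1] (ex_intro _ y yx)).
Qed.

Lemma residue_inv0 : residue_inv 0 = 0.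
Proof. by rewrite /residue_inv eqxx. Qed.

HB.instance Definition _ :=
  GRing.ComNzRing_isField.Build residue residue_mulVf residue_inv0.

(* Elements outside the valuation ring are sent to 0. *)
Definition reduction (x : F) : residue := \pi_residue (insubd (0 : valring) x).

End ResidueField.

Definition abs_extends (R : realFieldType) (p : nat) (pr_p : prime p)
    (K : fieldExtType (Qp pr_p)) (w : absval R K) : Prop :=
  forall x : Qp pr_p, w x%:A = ratr (Qp_abs pr_p x).

(* Ramification index 1: K and the base field have the same value group. *)
Definition unramified (R : realFieldType) (F : fieldType) (K : fieldExtType F)
    (w : absval R K) : Prop :=
  forall z : K, z != 0 -> exists2 x : F, x != 0 & w z = w x%:A.

Definition vp (p : nat) (R : realType) (F : fieldType) (w : absval R F) (x : F)
    : R :=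
  - (ln (w x) / ln p%:R).

(* Q_p is locally compact, not compact and Hausdorff, so the usual topology of
   the projective line is that of the one-point compactification;
   [None] is the point at infinity. *)
Notation P1 pr_p := (one_point_compactification (Qp pr_p)).

Definition homography (F : fieldType) (a b c d : F)
    (x : one_point_compactification F) : one_point_compactification F :=
  match x with
  | Some x => if c * x + d == 0 then None else Some ((a * x + b) / (c * x + d))
  | None => if c == 0 then None else Some (a / c)
  end.

Section Dynamics.
Variables (T : topologicalType) (f : T -> T).

Definition subsystem (E : set T) : Prop := compact E /\ f @` E `<=` E.

Definition minimal_subsystem (E : set T) : Prop :=
  subsystem E /\
  forall x, E x -> E = closure [set iter n f x | n in [set: nat]].

Definition minimal_decomposition (M : nat) (E : 'I_M -> set T) : Prop :=
  [/\ forall i, E i !=set0,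
      forall i, minimal_subsystem (E i),
      trivIset [set: 'I_M] E
    & \bigcup_i E i = [set: T]].

End Dynamics.

Definition topologically_conjugate (T U : topologicalType)
    (f : T -> T) (E : set T) (g : U -> U) (D : set U) : Prop :=
  exists (h : T -> U) (k : U -> T),
    [/\ {homo h : x / E x >-> D x},
        {homo k : y / D y >-> E y},
        {in E, cancel h k} /\ {in D, cancel k h},
        {within E, continuous h} /\ {within D, continuous k}
      & {in E, forall x, h (f x) = g (h x)}].

(* For n > 0, ['I_n.-1.+1] is ['I_n], i.e. Z/nZ (including n = 1, which ['Z_n]
   does not handle), and [inZp] is reduction modulo n. *)
Notation odometer_space ps :=
  (prod_topology (fun s => discrete_topology 'I_(ps s).-1.+1)).

Definition odometer (ps : nat -> nat) : set (odometer_space ps) :=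
  [set x | forall s, x s = inZp (nat_of_ord (x s.+1))].

Definition adding_machine (ps : nat -> nat) (x : odometer_space ps) :
  odometer_space ps := fun s => inZp (nat_of_ord (x s)).+1.

Arguments odometer ps : clear implicits.
Arguments adding_machine ps x : clear implicits.

(* Main.v *)
Require Import Defs.
From HB Require Import structures.
From mathcomp Require Import all_boot all_order all_algebra all_field.
From mathcomp Require Import all_classical all_reals all_analysis.
From mathcomp Require Import ring_quotient ring zify.

Set Implicit Arguments.
Unset Strict Implicit.
Unset Printing Implicit Defensive.

(** Put chi(x) = (2cx + d - a + sqrt Delta) / (2cx + d - a - sqrt Delta) and
    chi(oo) = 1.  This identifies P^1(Q_p) with the elements of norm one of K
    and turns phi into multiplication by lambda, so phi is an isometry of the
    distance |chi(x) - chi(y)|.  As K is unramified, sqrt Delta is a unit up to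
    a factor in Q_p; Hensel's lemma then shows that this distance is the chordal
    one, so that its closed balls of radius p^-(m+1) are the p^m (p + 1) residue
    discs of P^1.  With v = v_p(lambda^l - 1), lifting the exponent gives
    |lambda^n - 1| <= p^-(v+s) iff l p^s divides n, so phi permutes the discs of
    radius p^-(v+s) freely with all orbits of length l p^s: the number of orbits
    (p + 1) p^(v-1) / l does not depend on s, and the inverse limit over s of
    each orbit is an odometer.  Counting discs of radius 1/p gives l | p + 1. *)

Import Order.TTheory GRing.Theory Num.Theory.
Local Open Scope classical_set_scope.
Local Open Scope ring_scope.

(** * Orbits of equal length on a finite quotient *)

Section FreeOrbits.
Variables (T : Type) (f : T -> T) (X : finType) (pi : T -> X) (N : nat).
Hypothesis pi_surj : forall x, exists t, pi t = x.
Hypothesis pi_equiv : forall s t, pi s = pi t -> pi (f s) = pi (f t).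

Lemma pi_equiv_iter n s t : pi s = pi t -> pi (iter n f s) = pi (iter n f t).
Proof. by move=> st; elim: n => // n IHn; exact: pi_equiv. Qed.

Hypothesis N_gt0 : (0 < N)%N.
Hypothesis pi_period : forall n t, pi (iter n f t) = pi t <-> (N %| n)%N.

Lemma pi_iter_inj m n t : pi (iter m f t) = pi (iter n f t) <-> m = n %[mod N].
Proof.
wlog mn : m n / (m <= n)%N.
  move=> W; have [mn|/ltnW nm] := leqP m n; first exact: W.
  by have [h1 h2] := W n m nm; split=> [/esym/h1|/esym/h2].
rewrite -(subnK mn) iterD; split=> [/esym/pi_period Nd|].
  by rewrite -modnDml (eqP Nd).
move=> h; apply/esym/pi_period.
by move: h; rewrite subnK // => h; rewrite -eqn_mod_dvd // h.
Qed.

(** By [pi_equiv], [f] descends to a self-map [g] of [X]; by [pi_period], [g] is a permutation with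
    all cycles of length [N]. So [M] is the number of cycles, and the [t i] lift one point of each
    cycle. *)
Lemma orbit_representatives : exists M, #|X| = (M * N)%N /\
  exists t : 'I_M -> T, forall i j m n,
    pi (iter m f (t i)) = pi (iter n f (t j)) -> i = j.
Proof.
have [r rK] := choice pi_surj.
pose g x := pi (f (r x)).
have gpi t : g (pi t) = pi (f t) by apply: pi_equiv; rewrite rK.
have gpin n t : iter n g (pi t) = pi (iter n f t).
  by elim: n => //= n ->.
have gN n x : iter n g x = x <-> (N %| n)%N.
  by rewrite -(rK x) gpin; exact: pi_period.
have g_inj : injective g.
  (* The power [N.-1] of [g] is a left inverse, since the [N]-th power is the identity. *)
  apply: (@can_inj _ _ _ (iter N.-1 g)) => x.
  by rewrite -iterSr prednK //; apply/gN.
have gord x : fingraph.order g x = N.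
  apply/eqP; rewrite eqn_dvd; apply/andP; split; last first.
    by apply/(gN _ x); rewrite iter_order.
  (* The remainder of [N] modulo the cycle length fixes [x] and is smaller than this length, so it
     is 0. *)
  have : iter (N %% fingraph.order g x) g x = x.
    have e k : iter (k * fingraph.order g x) g x = x.
      by elim: k => // k IHk; rewrite mulSn iterD IHk iter_order.
    have : iter N g x = x by apply/gN.
    by rewrite {1}(divn_eq N (fingraph.order g x)) addnC iterD e.
  have lt := ltn_pmod N (order_gt0 g x).
  move=> it; apply/eqP; move: (findex_iter lt).
  by rewrite it findex0.
have card : (fcard g X * N)%N = #|X|.
  by apply: fcard_order_set => //; apply/fintype.subsetP => x _; rewrite inE gord.
pose A := [set x in froots g]%SET.
have cA : #|A| = fcard g X.
  by rewrite cardsE; apply: eq_card => x; rewrite !inE andbT.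
exists #|A|; split; first by rewrite cA card.
exists (fun i => r (enum_val i)) => i j m n.
rewrite -!gpin !rK => e; apply: enum_val_inj.
have h k y : froot g (iter k g y) = froot g y.
  apply/esym/(fingraph.rootP (fconnect_sym g_inj)); exact: fconnect_iter.
have: froot g (enum_val i) = froot g (enum_val j) by rewrite -(h m) e h.
have hA y : y \in A -> froot g y = y by rewrite inE => /eqP.
by rewrite !hA ?enum_valP.
Qed.

End FreeOrbits.

(** * From compatible finite quotients to odometers *)

Section Odometer.
Variables (T : topologicalType) (f : T -> T) (X : nat -> finType).
Variables (pi : forall s, T -> X s) (N : nat -> nat).
Hypothesis T_compact : compact [set: T].
Hypothesis pi_surj : forall s x, exists t, pi s t = x.
Hypothesis pi_open : forall s t, nbhs t [set u | pi s u = pi s t].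
Hypothesis pi_compat : forall s t u, pi s.+1 t = pi s.+1 u -> pi s t = pi s u.
Hypothesis pi_separating : forall t u, (forall s, pi s t = pi s u) -> t = u.
Hypothesis pi_equiv : forall s t u, pi s t = pi s u -> pi s (f t) = pi s (f u).
Hypothesis N_gt0 : forall s, (0 < N s)%N.
Hypothesis pi_period : forall s n t, pi s (iter n f t) = pi s t <-> (N s %| n)%N.

Lemma pi_compat_le r s t u : (r <= s)%N -> pi s t = pi s u -> pi r t = pi r u.
Proof.
move=> /subnK<-; elim: (s - r)%N => // k IHk /pi_compat; exact: IHk.
Qed.

(** Any cluster point works: for [n] at least [s] the point [x n] stays in the level-[s] class of
    [x s], and the class of the cluster point is a neighbourhood, so it meets this tail. *)
Lemma pi_sequence_limit (x : nat -> T) :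
  (forall s, pi s (x s.+1) = pi s (x s)) -> exists y, forall s, pi s y = pi s (x s).
Proof.
move=> xS.
have [|y [_ ycl]] := @T_compact (x @ \oo) _; first exact: filterT.
exists y => s.
have xs n : (s <= n)%N -> pi s (x n) = pi s (x s).
  elim: n => [|n IHn]; first by rewrite leqn0 => /eqP->.
  rewrite leq_eqVlt => /orP[/eqP->//|sn].
  by rewrite -IHn //; apply: pi_compat_le (xS n).
have xA : (x @ \oo) [set t | pi s t = pi s (x s)] by exists s => // n /= /xs.
by have [t [/= <- <-]] := ycl _ _ xA (@pi_open s y).
Qed.

(** Otherwise pick at each level a point of the class of [t] outside [U]. A cluster point of these
    agrees with [t] at all levels, hence is [t], although the sequence avoids the neighbourhood
    [U]. *)
Lemma pi_nbhs_basis t U : nbhs t U -> exists s, forall u, pi s u = pi s t -> U u.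
Proof.
move=> tU; apply: contrapT => /forallNP nU.
have {nU} /choice[x xU] s : exists u, pi s u = pi s t /\ ~ U u.
  by have /existsNP[u /not_implyP[]] := nU s; exists u.
have [s|y yx] := @pi_sequence_limit x.
  by rewrite (proj1 (xU s)); apply: pi_compat; rewrite (proj1 (xU s.+1)).
have yt : y = t by apply: pi_separating => s; rewrite yx; exact: (proj1 (xU s)).
have [|z [_ zcl]] := @T_compact (x @ \oo) _; first exact: filterT.
have zt : z = t.
  apply: pi_separating => s.
  have xA : (x @ \oo) [set t' | pi s t' = pi s t].
    exists s => // n /= sn; apply: pi_compat_le sn _; exact: (proj1 (xU n)).
  by have [t' [/= <- <-]] := zcl _ _ xA (@pi_open s z).
have xA : (x @ \oo) (~` U) by exists 0%N => // n _ /=; exact: (proj2 (xU n)).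
by rewrite zt in zcl; have [t' []] := zcl _ _ xA tU.
Qed.

Variables (M : nat) (M_card : forall s, #|X s| = (M * N s)%N).

(** The orbits of [M] points that are separated at level 0 fill every level, because the level sizes
    are [M * N s]. Each point thus gets an orbit index and one digit modulo [N s] per level; the
    index cuts out the [E i], and the digits are the conjugacy, as [f] adds 1 to each digit. *)
Theorem odometer_decomposition : exists E : 'I_M -> set T,
  minimal_decomposition f E /\
  forall i, topologically_conjugate f (E i) (adding_machine N) (@odometer N).
Proof.
have [M' [cardM' [t t_inj]]] :=
  orbit_representatives (@pi_surj 0%N) (@pi_equiv 0%N) (N_gt0 0)
    (@pi_period 0%N).
have eM : M' = M.
  by apply/eqP; rewrite -(eqn_pmul2r (N_gt0 0)) -cardM' M_card.
subst M'.
have iter_inj s := pi_iter_inj (@pi_period s).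
(* The index can be read off at level 0 and the exponent modulo [N s] at level [s], so [F s] is
   injective, and by cardinality it is onto. *)
pose F s (z : 'I_M * 'I_(N s)) := pi s (iter z.2 f (t z.1)).
have F_inj s : injective (F s).
  move=> [i m] [j n] /= e.
  have ij : i = j.
    by apply: (t_inj i j m n); apply: pi_compat_le e.
  subst j; move: e => /iter_inj; rewrite !modn_small // => mn.
  by congr pair; apply/val_inj.
have F_onto s x : exists z, F s z = pi s x.
  have := inj_card_onto (F_inj s); rewrite card_prod !card_ord M_card => /(_ (leqnn _) (pi s x)).
  by move=> /codomP[z ->]; exists z.
have {F_inj F_onto} codes x : exists ic : 'I_M * (nat -> nat),
    forall s, (ic.2 s < N s)%N /\ pi s (iter (ic.2 s) f (t ic.1)) = pi s x.
  pose z s := projT1 (cid (F_onto s x)).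
  have zP s : F s (z s) = pi s x by exact: projT2 (cid (F_onto s x)).
  exists ((z 0%N).1, fun s => (z s).2 : nat) => s; split=> //=.
  rewrite -zP; congr (pi s (iter _ f (t _))); apply: (t_inj _ _ (z 0%N).2 (z s).2).
  transitivity (pi 0%N x); first exact: zP.
  by symmetry; apply: pi_compat_le (zP s).
have {codes} [ic icP] := choice codes.
(* [cl] is the orbit index and [c x s] the digit of [x] at level [s]. *)
pose cl x := (ic x).1; pose c x := (ic x).2.
have c_lt x s : (c x s < N s)%N by have [] := icP x s.
have cP x s : pi s (iter (c x s) f (t (cl x))) = pi s x by have [] := icP x s.
have code x s n i : pi s (iter n f (t i)) = pi s x <->
    cl x = i /\ c x s = (n %% N s)%N.
  rewrite -(cP x s); split=> [e|[<- ->]]; last by apply/iter_inj; rewrite modn_mod.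
  have ix : cl x = i by symmetry; apply: (t_inj _ _ n (c x s)); apply: pi_compat_le e.
  by split=> //; move: e; rewrite -ix => /iter_inj->; rewrite modn_small.
have cl_pi s x y : pi s x = pi s y -> cl x = cl y /\ c x s = c y s.
  by rewrite -(cP y s) => /esym/code; rewrite modn_small.
have cN x s : c x s.+1 = c x s %[mod N s].
  have := pi_compat (cP x s.+1); move=> /code[_ ->].
  by rewrite modn_mod.
have cf x s : cl (f x) = cl x /\ c (f x) s = ((c x s).+1 %% N s)%N.
  by apply/code; rewrite iterS; apply: pi_equiv; exact: cP.
have clf n x : cl (iter n f x) = cl x by elim: n => //= n <-; case: (cf (iter n f x) 0%N).
have cfn n x s : c (iter n f x) s = ((c x s + n) %% N s)%N.
  apply: (proj2 (proj1 (code _ s _ (cl x)) _)).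
  by rewrite addnC iterD; exact: (pi_equiv_iter (@pi_equiv s) n (cP x s)).
have c_inj x y : cl x = cl y -> (forall s, c x s = c y s) -> x = y.
  by move=> xy cxy; apply: pi_separating => s; rewrite -(cP x) -(cP y) xy cxy.
pose E i := [set x | cl x = i].
have cl_open x : nbhs x [set y | cl y = cl x].
  by apply: filterS (@pi_open 0%N x) => y /= /cl_pi[].
have E_closed i : closed (E i).
  move=> x; rewrite /closure /= => /(_ _ (cl_open x))[y [/= <- ->]] //.
exists E; split.
  split.
  - by move=> i; exists (t i); have /code[] : pi 0%N (iter 0 f (t i)) = pi 0%N (t i) by [].
  - move=> i; split; first split.
    + by apply: (subclosed_compact (E_closed i) T_compact).
    + by move=> _ [x /= <- <-]; have [] := cf x 0%N.
    + move=> x Ex; apply/seteqP; split=> [y Ey U /pi_nbhs_basis[s sU]|].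
        (* The exponent is the difference of the digits modulo [N s]; adding [N s] keeps the
           subtraction in [nat] from truncating. *)
        exists (iter (c y s + (N s - c x s)) f x); split; first by eexists.
        apply: sU; rewrite -(cP y s); symmetry; apply/code.
        rewrite clf cfn Ex Ey; split=> //.
        by rewrite addnCA subnKC ?(ltnW (c_lt _ _)) // modnDr.
      move=> y; rewrite (closure_id (E i)).1 //; apply: closureS => _ [n _ <-] /=.
      by rewrite /E /= clf.
  - by apply/trivIsetP => i j _ _ ij; apply/seteqP; split=> // x [Ei Ej]; move: ij; rewrite -[i]Ei -[j]Ej eqxx.
  - by apply/seteqP; split=> // x _; exists (cl x).
move=> i.
have NE s : (N s).-1.+1 = N s by rewrite prednK.
pose h x : odometer_space N := fun s => inord (c x s).
have hE x s : h x s = c x s :> nat by rewrite inordK // NE.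
have hD x : @odometer N (h x).
  move=> s; apply/val_inj; rewrite [LHS]hE.
  rewrite [RHS](_ : _ = (c x s.+1 %% N s)%N); first by rewrite cN modn_small.
  by congr (_ %% _)%N; [exact: hE | exact: NE].
(* On the odometer, the inverse is the limit of the points of the orbit of [t i] whose exponents are
   the coordinates of [u]; elsewhere it takes the default value [t i]. *)
have kP (u : odometer_space N) : exists x, @odometer N u -> E i x /\ h x = u.
  have [Du|nDu] := pselect (@odometer N u); last by exists (t i).
  have [|x xP] := @pi_sequence_limit (fun s => iter (u s) f (t i)).
    move=> s; apply/iter_inj; have -> : u s = (u s.+1 %% N s)%N :> nat.
      by rewrite Du; congr (_ %% _)%N; exact: NE.
    by rewrite modn_mod.
  exists x => _; split; first by have /esym/code[] := xP 0%N.
  apply: functional_extensionality_dep => s; apply/val_inj; rewrite [LHS]hE.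
  have /esym/code[_ ->] := xP s.
  by rewrite modn_small // -[X in (_ < X)%N](NE s).
have [k kE] := choice kP.
exists h, k; split.
- by move=> x _; exact: hD.
- by move=> u Du; have [] := kE _ Du.
- split.
  + move=> x /set_mem Ex; have [Ek hk] := kE _ (hD x).
    by apply: c_inj; [rewrite Ek Ex|move=> s; rewrite -!hE hk].
  + by move=> u /set_mem Du; have [_ ->] := kE _ Du.
- split.
  (* In the product topology it suffices that each digit be locally constant, and the digit at level
     [s] is constant on the open classes of [pi s]. *)
  + apply: continuous_subspaceT => x; apply/cvg_sup => s U [/= _ [[V oV <-] /= Vhx]] VU.
    apply: filterS (@pi_open s x) => y /= yx; apply: VU => /=.
    by rewrite (_ : h y s = h x s) // /h (cl_pi _ _ _ yx).2.
  (* Fixing the single coordinate [s] of [u] already confines its image to one class of [pi s]. *)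
  + apply/subspace_continuousP => u Du U /pi_nbhs_basis[s sU].
    have [Ek hk] := kE _ Du.
    have := @proj_continuous _ (fun s => discrete_topology 'I_(N s).-1.+1) s u _ (discrete_set1 _).
    rewrite /= !nbhs_simpl /= => us.
    rewrite /within /=; near=> w => Dw; apply: sU.
    have [Ew hw] := kE _ Dw.
    rewrite -(cP (k u) s); symmetry; apply/code.
    rewrite Ew Ek; split=> //; rewrite modn_small // -!hE hk hw.
    by congr nat_of_ord; near: w.
- move=> x _; apply: functional_extensionality_dep => s; apply/val_inj; rewrite [LHS]hE.
  rewrite [RHS](_ : _ = ((c x s).+1 %% N s)%N); first by have [] := cf x s.
  by congr (_.+1 %% _)%N; [exact: hE | exact: NE].
Unshelve. all: by end_near.
Qed.

End Odometer.

(** * Density of a valued field in its completion *)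

Section CompletionDense.
Local Open Scope quotient_scope.
Variables (R : realFieldType) (F : fieldType) (v : absval R F).

Lemma cauchy_cst (a : F) : (fun _ : nat => a) \in cauchy_pred v.
Proof.
by apply/cauchy_predP => e e0; exists 0%N => m n _ _; rewrite subrr absf0.
Qed.

Definition completion_inj (a : F) : completion v :=
  \pi_(completion v) (CauchySeq (cauchy_cst a)).

Lemma completion_inj_zmod_morphism : zmod_morphism completion_inj.
Proof.
move=> a b; rewrite /completion_inj -rmorphB; congr (\pi_(completion v) _).
exact/val_inj.
Qed.


HB.instance Definition _ := GRing.isZmodMorphism.Build F (completion v)
  completion_inj completion_inj_zmod_morphism.

Lemma completion_inj_monoid_morphism : monoid_morphism completion_inj.
Proof.
split; first by rewrite -(rmorph1 \pi_(completion v)); congr (\pi_(completion v) _); exact/val_inj.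
move=> a b; rewrite /completion_inj -rmorphM; congr (\pi_(completion v) _).
exact/val_inj.
Qed.

HB.instance Definition _ := GRing.isMonoidMorphism.Build F (completion v)
  completion_inj completion_inj_monoid_morphism.

Lemma completion_abs_inj a : completion_abs v (completion_inj a) = v a.
Proof.
have [->|a0] := eqVneq a 0; first by rewrite rmorph0 !absf0.
by apply: completion_absf_pi; rewrite ?absf_gt0 //; exists 0%N.
Qed.

(** The absolute value of a nonzero class is attained by the far terms of its chosen representative,
    and these differ from the terms of [u] by less than that value. *)
Lemma completion_abs_pi_le (u : cauchyType v) (e : R) : 0 <= e ->
  (exists N, forall n, (N <= n)%N -> v (u n) <= e) ->
  completion_abs v (\pi_(completion v) u) <= e.
Proof.
move=> e0 [N uN]; have [->|x0] := eqVneq (\pi_(completion v) u) 0.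
  by rewrite absf0.
have [r0 [N1 rN]] := completion_absf_repr x0.
have := eqxx (\pi_(completion v) u); rewrite -[in X in X == _](reprK (\pi_(completion v) u)).
rewrite completion_pi_eq => /null_predP/(_ _ r0)[N2 dN].
pose n := maxn N (maxn N1 N2).
have [nN [nN1 nN2]] : (N <= n)%N /\ (N1 <= n)%N /\ (N2 <= n)%N.
  by rewrite /n !leq_max !leqnn !orbT.
have := dN n nN2; rewrite -(rN n nN1) => d.
rewrite -[X in X <= _](rN n nN1) (_ : v _ = v (u n)) ?uN //.
by symmetry; apply: absf_eqr; rewrite absfBC.
Qed.

Lemma completion_dense (x : completion v) (e : R) : 0 < e ->
  exists a, completion_abs v (x - completion_inj a) <= e.
Proof.
move=> e0; have [N xN] := Defs.cauchyP (repr x) e0.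
exists (repr x N); move: xN; set a := repr x N => xN.
rewrite -[x in X in X <= _]reprK -rmorphB.
apply: completion_abs_pi_le; first exact: ltW.
by exists N => n Nn; exact: ltW (xN n N Nn (leqnn N)).
Qed.

End CompletionDense.

(** * Values, residues and completeness of [Qp] *)

Lemma inv_prime_exp_lt (R : archiRealFieldType) (p : nat) (e : R) :
  prime p -> 0 < e -> exists n, p%:R^-1 ^+ n < e.
Proof.
move=> pr_p e0; have p0 n : 0 < p%:R ^+ n :> R by rewrite exprn_gt0 // ltr0n prime_gt0.
exists (Num.bound e^-1); rewrite exprVn invf_plt ?posrE //.
apply: lt_trans (archi_boundP _) _; first by rewrite invr_ge0 ltW.
by rewrite -natrX ltr_nat ltn_expl ?prime_gt1.
Qed.

Section QpFacts.
Variables (p : nat) (pr_p : prime p).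
Local Notation Q := (Qp pr_p).
Local Notation abs := (Qp_abs pr_p).
Local Notation q := ((p%:R : rat)^-1).

Let p_gt0 : 0 < (p%:R : rat). Proof. by rewrite ltr0n prime_gt0. Qed.
Let p_gt1 : 1 < (p%:R : rat). Proof. by rewrite ltr1n prime_gt1. Qed.
Let q_gt0 : 0 < q. Proof. by rewrite invr_gt0. Qed.
Let q_lt1 : q < 1. Proof. by rewrite invf_lt1. Qed.

Lemma Qp_absq_int (m : int) : rat_padic_abs pr_p m%:~R = padic_absz p m.
Proof.
transitivity (padic_absq p (m%:~R / 1%:~R)); first by rewrite divr1.
by rewrite padic_absq_frac // [padic_absz p 1]/padic_absz /= logn1 expr0 invr1 divr1.
Qed.

Lemma Qp_abs_int (m : int) : abs m%:~R = padic_absz p m.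
Proof.
by rewrite -Qp_absq_int -[RHS]completion_abs_inj rmorph_int.
Qed.

Lemma padic_absz_le (m : int) n : (padic_absz p m <= q ^+ n) = (p ^ n %| `|m|)%N.
Proof.
rewrite /padic_absz; case: eqVneq => [->|m0]; first by rewrite dvdn0 exprn_ge0 // ltW.
rewrite exprVn lef_pV2 ?posrE ?exprn_gt0 // ler_eXn2l //.
by rewrite pfactor_dvdn // absz_gt0.
Qed.

Lemma Qp_abs_int_le (m : int) n : (abs m%:~R <= q ^+ n) = (p ^ n %| `|m|)%N.
Proof. by rewrite Qp_abs_int padic_absz_le. Qed.

Lemma Qp_abs_nat_le m n : (abs m%:R <= q ^+ n) = (p ^ n %| m)%N.
Proof. exact: (Qp_abs_int_le m n). Qed.

Lemma Qp_abs_nat_le1 m : abs m%:R <= 1.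
Proof. by rewrite (Qp_abs_nat_le m 0) dvd1n. Qed.

Lemma Qp_abs_p : abs p%:R = q.
Proof.
by rewrite (Qp_abs_int p) /padic_absz eqz_nat eqn0Ngt prime_gt0 //= logn_prime // eqxx expr1.
Qed.

(** Completing does not enlarge the value group: the absolute value of a nonzero class is that of a
    rational term far out. *)
Lemma Qp_abs_value (x : Q) : x != 0 -> exists k : int, abs x = p%:R ^ k.
Proof.
move=> x0; have [r0 [N xN]] := completion_absf_repr x0.
have : 0 < abs x by [].
have -> : abs x = rat_padic_abs pr_p (repr x N) by symmetry; exact: xN.
set a := repr x N.
rewrite absf_gt0 => a0.
exists ((logn p `|denq a|)%:Z - (logn p `|numq a|)%:Z).
rewrite [LHS]/(padic_absz p (numq a) / padic_absz p (denq a)).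
rewrite /padic_absz numq_eq0 (negbTE a0) (negbTE (denq_neq0 _)) invrK.
by rewrite expfzDr ?gt_eqF // exprnN exprnP mulrC.
Qed.

Lemma Qp_abs_lt1 (x : Q) : abs x < 1 -> abs x <= q.
Proof.
have [->|x0] := eqVneq x 0; first by rewrite absf0 ltW.
have [k ->] := Qp_abs_value x0.
rewrite -(expr0z (p%:R : rat)) ltr_eXz2l // => k0.
by rewrite -exprN1 ler_eXz2l //; lia.
Qed.

Lemma Qp_abs_natN m : ~~ (p %| m)%N -> abs m%:R = 1.
Proof.
move=> pm; apply: le_anti; rewrite Qp_abs_nat_le1 leNgt /=.
by apply: contra pm => /Qp_abs_lt1; rewrite -[q]expr1 Qp_abs_nat_le.
Qed.

(** A rational approximation of an integral element has a denominator prime to p, which can be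
    inverted modulo p^n. *)
Lemma Qp_residue (x : Q) n : abs x <= 1 ->
  exists k : 'I_(p ^ n), abs (x - k%:R) <= q ^+ n.
Proof.
move=> x1; have [a xa] := completion_dense x (exprn_gt0 n q_gt0).
have qn1 : q ^+ n <= 1 by rewrite exprn_ile1 // ltW.
have a1 : rat_padic_abs pr_p a <= 1.
  rewrite -completion_abs_inj -(subKr x (completion_inj _ _)).
  by rewrite (le_trans (absfB _ _ _)) // ge_max x1 (le_trans xa).
(* If p divided the denominator, integrality of [a] would make it divide the numerator too, against
   coprimality. *)
have den1 : abs (denq a)%:~R = 1.
  apply: le_anti; rewrite -[X in _ <= X](expr0 q) Qp_abs_int_le dvd1n leNgt /=.
  apply/negP => /Qp_abs_lt1; rewrite -[q]expr1 Qp_abs_int_le expn1 => pd.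
  have : rat_padic_abs pr_p (numq a)%:~R <= q ^+ 1.
    have -> : (numq a)%:~R = a * (denq a)%:~R by rewrite -{2}(divq_num_den a) divfK // intr_eq0.
    rewrite absfM -[X in _ <= X]mul1r ler_pM ?absf_ge0 //.
    by rewrite Qp_absq_int padic_absz_le.
  rewrite Qp_absq_int padic_absz_le expn1 => pn.
  have := dvdn_gcd p `|numq a| `|denq a|; rewrite pd pn.
  by rewrite (eqP (coprime_num_den a)) dvdn1 => /eqP p1; move: pr_p; rewrite p1.
have cop : coprimez (denq a) (p ^ n)%:Z.
  rewrite coprimezE absz_nat coprimeXr // coprime_sym prime_coprime //.
  move: den1; rewrite Qp_abs_int => d1; rewrite -[p]expn1 -padic_absz_le d1.
  by rewrite expr1 -ltNge.
have [[e e'] /= eP] := coprimezP _ _ cop.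
have pn0 : (0 < p ^ n)%N by rewrite expn_gt0 prime_gt0.
(* By the Bezout relation [eP], [e] inverts the denominator modulo p^n. *)
pose k := ((numq a * e) %% (p ^ n)%:Z)%Z.
have k_ge0 : 0 <= k by rewrite modz_ge0 // gt_eqF.
have k_lt : (`|k| < p ^ n)%N.
  by rewrite -ltz_nat gez0_abs // ltz_pmod.
exists (Ordinal k_lt); rewrite [nat_of_ord _]/=.
rewrite -[`|k|%:R]/(`|k|%N%:~R) gez0_abs //.
rewrite -[x - _](subrKA (completion_inj _ a)).
apply: (le_trans (absfD abs _ _)); rewrite ge_max xa andTb.
(* Multiplying by the denominator, which is a unit, turns the estimate into a divisibility of
   integers. *)
rewrite -[X in X <= _]mulr1 -[X in _ * X]den1 -absfM mulrBl.
have -> : completion_inj (rat_padic_abs pr_p) a * (denq a)%:~R = (numq a)%:~R.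
  by rewrite -(rmorph_int (completion_inj _)) -rmorphM /= -{1}(divq_num_den a) divfK ?rmorph_int // intr_eq0.
rewrite -intrM -intrB Qp_abs_int_le -[(p ^ n)%N]absz_nat -dvdzE.
have -> : numq a - k * denq a = (numq a * e - k) * denq a + numq a * e' * (p ^ n)%:Z.
  by transitivity (numq a * (e * denq a + e' * (p ^ n)%:Z) - k * denq a); [rewrite eP mulr1|ring].
apply: rpredD; last exact: dvdz_mull.
by apply: dvdz_mulr; rewrite -eqz_mod_dvd modz_mod.
Qed.

Lemma Qp_small_eq0 (x : Q) : (forall n, abs x <= q ^+ n) -> x = 0.
Proof.
move=> xs; apply/eqP; rewrite -(absf_eq0 abs) -[_ == _]negbK; apply/negP => x0.
have /(inv_prime_exp_lt pr_p)[n] : 0 < abs x by rewrite lt_neqAle eq_sym x0 absf_ge0.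
by rewrite ltNge xs.
Qed.

(** Replacing each [x n] by a rational within [q ^+ n] yields, by the ultrametric inequality, a
    rational Cauchy sequence; its class is the limit. *)
Lemma Qp_complete (x : nat -> Q) : (forall n, abs (x n.+1 - x n) <= q ^+ n) ->
  exists y, forall n, abs (y - x n) <= q ^+ n.
Proof.
move=> xS; have qn n : 0 < q ^+ n by rewrite exprn_gt0.
have qle m n : (m <= n)%N -> q ^+ n <= q ^+ m by move=> mn; rewrite ler_iXn2l.
have [a aP] := choice (fun n => completion_dense (x n) (qn n)).
have xd m n : (m <= n)%N -> abs (x n - x m) <= q ^+ m.
  elim: n => [|n IHn]; first by rewrite leqn0 => /eqP->; rewrite subrr absf0 ltW.
  rewrite leq_eqVlt => /orP[/eqP->|mn]; first by rewrite subrr absf0 ltW.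
  rewrite -[x n.+1 - _](subrKA (x n)) (le_trans (absfD _ _ _)) // ge_max IHn // andbT.
  by rewrite (le_trans (xS n)) // qle.
have ad m n : (m <= n)%N -> rat_padic_abs pr_p (a n - a m) <= q ^+ m.
  move=> mn; rewrite -completion_abs_inj.
  rewrite (_ : completion_inj _ _ = (x m - completion_inj _ (a m)) +
    ((x n - x m) - (x n - completion_inj _ (a n)))); last by rewrite rmorphB /=; ring.
  rewrite (le_trans (absfD _ _ _)) // ge_max aP andTb (le_trans (absfB _ _ _)) //.
  by rewrite ge_max xd // (le_trans (aP n)) // qle.
have ca : a \in cauchy_pred (rat_padic_abs pr_p).
  apply/cauchy_predP => e /(inv_prime_exp_lt pr_p)[N Ne]; exists N => m n Nm Nn.
  apply: le_lt_trans Ne; wlog mn : m n Nm Nn / (m <= n)%N.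
    by move=> W; have [/W|/ltnW/W] := leqP m n; [|rewrite absfBC]; apply.
  by rewrite absfBC (le_trans (ad _ _ mn)) // qle.
exists (\pi_(completion _) (CauchySeq ca))%qT => n.
rewrite -[_ - x n](subrKA (completion_inj _ (a n))) (le_trans (absfD _ _ _)) //.
rewrite ge_max; apply/andP; split; last by rewrite absfBC; exact: aP.
have -> : \pi_(completion _)%qT (CauchySeq ca) - completion_inj _ (a n) =
    \pi_(completion _)%qT (CauchySeq ca - CauchySeq (cauchy_cst _ (a n))).
  by symmetry; exact: rmorphB.
apply: completion_abs_pi_le; first exact: ltW.
by exists n => k nk; exact: ad.
Qed.

End QpFacts.

(** * Hensel's lemma for square roots; topology of [Qp] and of its projective line *)

Lemma newton_sqrt_residual (F : fieldType) (y D : F) : 2%:R != 0 :> F -> y != 0 ->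
  (y - (y ^+ 2 - D) / (2%:R * y)) ^+ 2 - D = ((y ^+ 2 - D) / (2%:R * y)) ^+ 2.
Proof. by move=> t0 y0; field; rewrite y0 t0. Qed.

Section QpHenselTopology.
Variables (p : nat) (pr_p : prime p).
Local Notation Q := (Qp pr_p).
Local Notation abs := (Qp_abs pr_p).
Local Notation q := ((p%:R : rat)^-1).

Let p_gt0 : 0 < (p%:R : rat). Proof. by rewrite ltr0n prime_gt0. Qed.
Let p_gt1 : 1 < (p%:R : rat). Proof. by rewrite ltr1n prime_gt1. Qed.
Let q_gt0 : 0 < q. Proof. by rewrite invr_gt0. Qed.
Let q_lt1 : q < 1. Proof. by rewrite invf_lt1. Qed.
Let qn_gt0 n : 0 < q ^+ n. Proof. by rewrite exprn_gt0. Qed.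

(** Newton's iteration from [u] stays among units. As 2 is a unit for odd p, each step squares the
    size of the residual y^2 - D, so the iterates converge to a root. *)
Lemma Qp_hensel_sqrt (D u : Q) : (3 <= p)%N -> abs D = 1 ->
  abs (u ^+ 2 - D) < 1 -> exists y, y ^+ 2 = D.
Proof.
move=> p_ge3 D1 uD.
have two1 : abs 2%:R = 1.
  by apply: Qp_abs_natN; apply/negP => /dvdn_leq; lia.
have unit_near (y : Q) : abs (y ^+ 2 - D) < 1 -> abs y = 1.
  rewrite -D1 => /absf_eqr; rewrite D1 expr2 absfM => /eqP.
  rewrite -expr2 sqrf_eq1 => /orP[/eqP//|/eqP yN].
  by have := absf_ge0 abs y; rewrite yN oppr_ge0 ler10.
pose step y := y - (y ^+ 2 - D) / (2%:R * y).
pose x n := iter n step u.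
have stepE y n : abs (y ^+ 2 - D) <= q ^+ n.+1 ->
    abs (step y ^+ 2 - D) <= q ^+ n.+2 /\ abs (step y - y) <= q ^+ n.+1.
  move=> yn; have y1 : abs y = 1.
    by apply: unit_near; apply: le_lt_trans yn _; rewrite exprn_ilt1 // ltW.
  have y0 : y != 0 by rewrite -(absf_eq0 abs) y1 oner_eq0.
  have t0 : (2%:R : Q) != 0 by rewrite -(absf_eq0 abs) two1 oner_eq0.
  have eE : abs ((y ^+ 2 - D) / (2%:R * y)) = abs (y ^+ 2 - D).
    by rewrite absfM absfV absfM two1 y1 mulr1 invr1 mulr1.
  split; last by rewrite /step addrAC subrr add0r absfN eE.
  have -> : step y ^+ 2 - D = ((y ^+ 2 - D) / (2%:R * y)) ^+ 2.
    exact: newton_sqrt_residual.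
  rewrite expr2 absfM eE.
  apply: (@le_trans _ _ (q ^+ n.+1 * q ^+ n.+1)); first by rewrite ler_pM ?absf_ge0.
  rewrite -exprD ler_iXn2l //.
  by lia.
have xD n : abs (x n ^+ 2 - D) <= q ^+ n.+1.
  elim: n => [|n /stepE[]//]; rewrite expr1; exact: Qp_abs_lt1.
have [y yx] : exists y, forall n, abs (y - x n) <= q ^+ n.
  apply: Qp_complete => n; have [_ /le_trans] := stepE _ _ (xD n); apply.
  by rewrite ler_iXn2l.
exists y; apply/eqP; rewrite -subr_eq0; apply/eqP; apply: Qp_small_eq0 => n.
have -> : y ^+ 2 - D = (y - x n) * (y + x n) + (x n ^+ 2 - D) by ring.
apply: (le_trans (absfD abs _ _)); rewrite ge_max; apply/andP; split; last first.
  by apply: (le_trans (xD n)); rewrite ler_iXn2l.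
have x1 : abs (x n) = 1.
  by apply: unit_near; apply: le_lt_trans (xD n) _; rewrite exprn_ilt1 // ltW.
have qn1 : q ^+ n <= 1 by rewrite exprn_ile1 // ltW.
rewrite absfM -[X in _ <= X]mulr1 ler_pM ?absf_ge0 //.
have -> : y + x n = (y - x n) + (x n + x n) by ring.
apply: (le_trans (absfD abs _ _)); rewrite ge_max (le_trans (yx n)) //=.
by apply: (le_trans (absfD abs _ _)); rewrite x1 maxxx.
Qed.

Lemma Qp_nbhsP (x : Q) (U : set Q) :
  nbhs x U <-> exists2 e : rat, 0 < e & forall y, abs (x - y) < e -> U y.
Proof.
split=> [/nbhs_ballP[e /= e0 eU]|[e e0 eU]]; first by exists e.
by apply/nbhs_ballP; exists e.
Qed.

(** Primality of ultrafilters for finite unions; it selects one disc among the finitely many that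
    cover a ball. *)
Lemma ultra_bigcup (T : Type) (F : set_system T) (UF : UltraFilter F)
    (A : nat -> set T) (N : nat) :
  F [set x | exists2 k, (k < N)%N & A k x] -> exists2 k, (k < N)%N & F (A k).
Proof.
elim: N => [FA|N IHN FA].
  have : F set0 by apply: filterS FA => x [].
  by move=> /filter_not_empty.
have [FN|] := pselect (F (A N)); first by exists N.
move=> nFN; have [//|FN] := in_ultra_setVsetC (A N) UF.
have [|k kN Fk] := IHN; last by exists k => //; exact: ltnW.
apply: filterS (filterI FA FN) => x [[k]]; rewrite ltnS leq_eqVlt => /orP[/eqP-> //|kN Ak _].
by exists k.
Qed.

(** An ultrafilter on the ball contains a disc of each radius [q ^+ n]. Discs of successive radii
    meet, so their centres converge, and the ultrafilter converges to the same limit. *)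
Lemma Qp_ball_compact (C : nat) : compact [set x : Q | abs x <= p%:R ^+ C].
Proof.
rewrite compact_ultra => F UF FB.
have cover n : exists c : Q, F [set x | abs (x - c) <= q ^+ n].
  have pC0 : (p%:R ^+ C : Q) != 0.
    by rewrite expf_neq0 // -(absf_eq0 abs) Qp_abs_p invr_neq0 // gt_eqF.
  have absX k : abs (p%:R ^+ k) = q ^+ k.
    by elim: k => [|k IHk]; rewrite ?expr0 ?absf1 // !exprS absfM IHk Qp_abs_p.
  (* Multiplication by p^C carries the ball into the integers and the radius q^n to q^(C+n), so
     p^(C+n) centres k / p^C suffice. *)
  have [|k _ Fk] := @ultra_bigcup _ F UF
      (fun k => [set x : Q | abs (x - k%:R / p%:R ^+ C) <= q ^+ n]) (p ^ (C + n))%N.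
    apply: filterS FB => x /= xC.
    have px1 : abs (p%:R ^+ C * x) <= 1.
      by rewrite absfM absX exprVn -ler_pdivlMl ?invr_gt0 ?exprn_gt0 // invrK mulr1.
    have [k kx] := Qp_residue (C + n) px1.
    have kx' : abs (x - k%:R / p%:R ^+ C) <= q ^+ n.
      have -> : x - k%:R / p%:R ^+ C = (p%:R ^+ C * x - k%:R) / p%:R ^+ C.
        by rewrite mulrBl mulrAC divff // mul1r.
      by rewrite absfM absfV absX ler_pdivrMr ?qn_gt0 // -exprD [(n + C)%N]addnC.
    by exists k.
  by exists (k%:R / p%:R ^+ C).
have [c cP] := choice cover.
have qle m n : (m <= n)%N -> q ^+ n <= q ^+ m by move=> mn; rewrite ler_iXn2l.
have [y yc] : exists y, forall n, abs (y - c n) <= q ^+ n.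
  apply: Qp_complete => n.
  have [x [/= x1 x2]] := filter_ex (filterI (cP n) (cP n.+1)).
  rewrite -[_ - _](subrKA x); apply: (le_trans (absfD abs _ _)).
  by rewrite ge_max x1 andbT absfBC (le_trans x2) // qle.
have yF n : F [set x | abs (y - x) <= q ^+ n].
  apply: filterS (cP n) => x /= xc; rewrite -[y - x](subrKA (c n)).
  by apply: (le_trans (absfD abs _ _)); rewrite ge_max yc absfBC xc.
exists y; split.
  have [x [/= x1 x2]] := filter_ex (filterI FB (yF 0%N)).
  have -> : y = x + (y - x) by ring.
  apply: (le_trans (absfD abs _ _)); rewrite ge_max x1 (le_trans x2) //.
  by rewrite expr0 exprn_ege1 // ltW.
move=> U /= /Qp_nbhsP[e /(inv_prime_exp_lt pr_p)[n ne] eU].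
by apply: filterS (yF n) => x /= yx; apply: eU; apply: le_lt_trans ne.
Qed.

(** The absolute value is locally constant away from 0. *)
Lemma Qp_ball_closed (C : nat) : closed [set x : Q | abs x <= p%:R ^+ C].
Proof.
move=> x xcl; rewrite /= leNgt; apply/negP => Cx.
have : nbhs x [set y | abs y = abs x].
  apply/Qp_nbhsP; exists (abs x); first by apply: lt_trans Cx; rewrite exprn_gt0.
  by move=> y yx; apply: absf_eqr; rewrite absfBC.
by move=> /xcl[y [/= + yx]]; rewrite yx leNgt Cx.
Qed.

Lemma P1_nbhs_infty (C : nat) :
  nbhs (None : P1 pr_p) [set x | if x is Some y then p%:R ^+ C < abs y else True].
Proof.
exists [set x | abs x <= p%:R ^+ C].
  by split; [exact: Qp_ball_compact|exact: Qp_ball_closed].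
by move=> _ [[y /= yC <-]|->] //; rewrite ltNge; apply/negP.
Qed.

End QpHenselTopology.

(** * Lifting the exponent in an ultrametric field *)

Section UltrametricPowers.
Variables (R : realFieldType) (K : fieldType) (w : absval R K).

Lemma absf_sum_le (n : nat) (F : nat -> K) (C : R) : 0 <= C ->
  (forall i, (i < n)%N -> w (F i) <= C) -> w (\sum_(i < n) F i) <= C.
Proof.
move=> C0; elim: n => [|n IHn] FC; first by rewrite big_ord0 absf0.
rewrite big_ord_recr /= (le_trans (absfD _ _ _)) // ge_max FC // andbT.
by apply: IHn => i /ltnW/FC.
Qed.

Lemma absfX x n : w (x ^+ n) = w x ^+ n.
Proof. by elim: n => [|n IHn]; rewrite ?absf1 // !exprS absfM IHn. Qed.

Lemma absf_nat_le1 n : w n%:R <= 1.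
Proof.
elim: n => [|n IHn]; first by rewrite absf0.
by rewrite -addn1 natrD (le_trans (absfD _ _ _)) // ge_max IHn absf1 lexx.
Qed.

Lemma absf_eq1 x : w (x - 1) < 1 -> w x = 1.
Proof. by move=> x1; rewrite -(absf1 w); apply: absf_eqr; rewrite absf1. Qed.

Lemma absf_expB1_le x n : w (x - 1) < 1 -> w (x ^+ n - 1) <= w (x - 1).
Proof.
move=> x1; rewrite subrX1 absfM -[X in _ <= X]mulr1 ler_pM ?absf_ge0 //.
apply: (absf_sum_le (F := fun i => x ^+ i)) => // i _.
by rewrite absfX (absf_eq1 x1) expr1n.
Qed.

Section LiftingTheExponent.
Variables (p : nat) (pr_p : prime p) (p_ge3 : (3 <= p)%N).
Hypothesis wp : w p%:R = p%:R^-1.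
Local Notation q := ((p%:R : R)^-1).

Let p_gt0 : 0 < (p%:R : R). Proof. by rewrite ltr0n prime_gt0. Qed.
Let p_gt1 : 1 < (p%:R : R). Proof. by rewrite ltr1n prime_gt1. Qed.
Let q_gt0 : 0 < q. Proof. by rewrite invr_gt0. Qed.
Let q_lt1 : q < 1. Proof. by rewrite invf_lt1. Qed.

(** By Bezout some multiple [u * n] is 1 modulo p, so it has absolute value 1 while neither factor
    exceeds 1. *)
Lemma absf_natN n : ~~ (p %| n)%N -> w n%:R = 1.
Proof.
move=> pn; have n_gt0 : (0 < n)%N by case: n pn; rewrite ?dvdn0.
have cop : coprime n p by rewrite coprime_sym prime_coprime.
case: (egcdnP p n_gt0) => u v uv _; move: uv; rewrite (eqP cop) => uv.
apply: le_anti; rewrite absf_nat_le1 /=.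
have : w (u%:R * n%:R) = 1.
  apply: absf_eq1; rewrite -natrM uv natrD addrK natrM absfM wp.
  by apply: le_lt_trans q_lt1; rewrite ler_piMl ?absf_nat_le1 // ltW.
by rewrite absfM => <-; rewrite ler_piMl ?absf_ge0 // absf_nat_le1.
Qed.

Variable x : K.
Hypothesis x1 : w (x - 1) <= q.

Let x1_lt1 : w (x - 1) < 1. Proof. exact: le_lt_trans q_lt1. Qed.

Lemma geometric_sum_near n : w (\sum_(i < n) x ^+ i - n%:R) <= w (x - 1).
Proof.
have -> : \sum_(i < n) x ^+ i - n%:R = \sum_(i < n) (x ^+ i - 1).
  by rewrite sumrB sumr_const card_ord.
apply: (absf_sum_le (F := fun i => x ^+ i - 1)) => [|i _]; first exact: absf_ge0.
exact: absf_expB1_le.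
Qed.

(** The cofactor 1 + x + ... + x^(n-1) of x - 1 is close to [n], which is a unit. *)
Lemma absf_expB1_unit n : ~~ (p %| n)%N -> w (x ^+ n - 1) = w (x - 1).
Proof.
move=> pn; rewrite subrX1 absfM -[RHS]mulr1; congr (_ * _).
rewrite -(absf_natN pn); apply: absf_eqr; rewrite absf_natN //.
exact: le_lt_trans (geometric_sum_near n) x1_lt1.
Qed.

(** The cofactor of x - 1 differs from p by x - 1 times a double sum. That sum is congruent to the
    binomial coefficient ['C(p, 2)], a multiple of p for odd p, so the difference is at most q^2 and
    the cofactor has the size of p. *)
Lemma absf_expB1_prime : w (x ^+ p - 1) = q * w (x - 1).
Proof.
rewrite subrX1 absfM mulrC; congr (_ * _); rewrite -wp; apply: absf_eqr.
have -> : \sum_(i < p) x ^+ i - p%:R = (x - 1) * \sum_(i < p) \sum_(j < i) x ^+ j.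
  transitivity (\sum_(i < p) (x ^+ i - 1)); first by rewrite sumrB sumr_const card_ord.
  by rewrite mulr_sumr; apply: eq_bigr => i _; exact: subrX1.
rewrite absfM wp.
have le_q : w (\sum_(i < p) \sum_(j < i) x ^+ j) <= q.
  have -> : \sum_(i < p) \sum_(j < i) x ^+ j =
      \sum_(i < p) (\sum_(j < i) x ^+ j - i%:R) + 'C(p, 2)%:R.
    by rewrite sumrB -natr_sum -(big_mkord predT id) -bin2_sum subrK.
  apply: (le_trans (absfD w _ _)); rewrite ge_max; apply/andP; split.
    apply: (absf_sum_le (F := fun i => \sum_(j < i) x ^+ j - i%:R)) => [|i _]; first exact: ltW.
    exact: le_trans (geometric_sum_near i) x1.
  have /dvdnP[k ->] : (p %| 'C(p, 2))%N by apply: prime_dvd_bin => //; lia.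
  by rewrite natrM absfM wp ler_piMl ?absf_nat_le1 // ltW.
apply: (@le_lt_trans _ _ (q * q)); first by rewrite ler_pM ?absf_ge0.
by rewrite -[X in _ < X]mulr1 ltr_pM2l.
Qed.

End LiftingTheExponent.

Lemma absf_expB1 p (pr_p : prime p) (p_ge3 : (3 <= p)%N) (wp : w p%:R = p%:R^-1)
    x k m : w (x - 1) <= p%:R^-1 -> ~~ (p %| m)%N ->
  w (x ^+ (p ^ k * m) - 1) = p%:R^-1 ^+ k * w (x - 1).
Proof.
move=> + pm; elim: k x => [|k IHk] x x1.
  by rewrite mul1n mul1r (@absf_expB1_unit p).
have q0 : 0 <= (p%:R : R)^-1 by rewrite invr_ge0 ler0n.
have q1 : (p%:R : R)^-1 <= 1 by rewrite invf_le1 ?ltr0n ?prime_gt0 // ler1n prime_gt0.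
have xp := absf_expB1_prime pr_p p_ge3 wp x1.
rewrite expnS -mulnA exprM IHk xp ?mulrA -?exprSr //.
by rewrite (le_trans _ x1) // ler_piMl ?absf_ge0.
Qed.

Lemma absf_expB1_le_dvd p (pr_p : prime p) (p_ge3 : (3 <= p)%N)
    (wp : w p%:R = p%:R^-1) x v s n : (0 < v)%N -> w (x - 1) = p%:R^-1 ^+ v ->
  (w (x ^+ n - 1) <= p%:R^-1 ^+ (v + s)) = (p ^ s %| n)%N.
Proof.
move=> v0 xv; have p1 : 1 < (p%:R : R) by rewrite ltr1n prime_gt1.
have p0 : 0 < (p%:R : R) by rewrite ltr0n prime_gt0.
have q0 : 0 < (p%:R : R)^-1 by rewrite invr_gt0.
have q1 : (p%:R : R)^-1 < 1 by rewrite invf_lt1.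
case: n => [|n]; first by rewrite subrr absf0 dvdn0 exprn_ge0 // ltW.
have [m pm ->] := pfactor_coprime pr_p (ltn0Sn n).
move: pm; rewrite prime_coprime // => pm.
rewrite mulnC absf_expB1 // xv -?exprD; last first.
  by rewrite -[X in _ <= X]expr1 ler_iXn2l // ltW.
rewrite ler_iXn2l // addnC leq_add2r.
have m0 : (0 < m)%N by case: m pm; rewrite ?dvdn0.
rewrite pfactor_dvdn ?muln_gt0 ?m0 ?expn_gt0 ?prime_gt0 // lognM ?m0 ?expn_gt0 ?prime_gt0 //.
have lm : logn p m = 0%N by rewrite logn_coprime // prime_coprime.
by rewrite pfactorK // lm addn0.
Qed.

End UltrametricPowers.

(** * Powers of the reduction in the residue field *)

Section Reduction.
Variables (R : realFieldType) (K : fieldType) (w : absval R K).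

(** The bound on [x] ensures that [reduction] is the true residue class and not its default value
    0. *)
Lemma reduction_expr_eq1 x n : w x <= 1 ->
  (reduction w x ^+ n == 1) = (w (x ^+ n - 1) < 1).
Proof.
move=> x1; have xV : x \in valring_pred w by [].
pose y : valring w := ValRing xV.
have -> : reduction w x = (\pi_(residue w) y)%qT.
  by congr (\pi_(residue w) _)%qT; apply/val_inj; rewrite val_insubd xV.
rewrite -rmorphXn -(rmorph1 (\pi_(residue w))%qT) -(Quotient.idealrBE (maxideal w)).
have e : \val (y ^+ n - 1) = x ^+ n - 1 by rewrite rmorphB rmorphXn rmorph1.
by rewrite -e.
Qed.

Lemma primitive_reduction_dvd x l n : w x <= 1 ->
  l.-primitive_root (reduction w x) -> (w (x ^+ n - 1) < 1) = (l %| n)%N.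
Proof.
by move=> x1 lx; rewrite -reduction_expr_eq1 // (prim_order_dvd lx).
Qed.

End Reduction.

(** * Reduction of p-adic integers modulo p^n *)

Section ResidueClass.
Variables (p : nat) (pr_p : prime p).
Local Notation Q := (Qp pr_p).
Local Notation abs := (Qp_abs pr_p).
Local Notation q := ((p%:R : rat)^-1).

Lemma Qp_ord_eq n (j k : 'I_(p ^ n)) : abs (j%:R - k%:R) <= q ^+ n -> j = k.
Proof.
wlog jk : j k / (k <= j)%N.
  by move=> W; have [/W//|/ltnW/W+ kj] := leqP k j; rewrite absfBC in kj; move=> ->.
rewrite -natrB // Qp_abs_nat_le => d; apply/val_inj/eqP.
rewrite eqn_leq jk andbT -subn_eq0.
have := ltn_ord j; move: d; case: (_ - _)%N (leq_subr k j) => // i ij /dvdn_leq; lia.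
Qed.

Lemma Qp_residue_class n : exists rho : Q -> 'I_(p ^ n),
  (forall x y, abs x <= 1 -> abs y <= 1 ->
     rho x = rho y <-> abs (x - y) <= q ^+ n) /\
  forall k : 'I_(p ^ n), rho k%:R = k.
Proof.
have /choice[rho rhoP] : forall x : Q, exists k : 'I_(p ^ n),
    abs x <= 1 -> abs (x - k%:R) <= q ^+ n.
  move=> x; have [/(Qp_residue n)[k kx]|x1] := boolP (abs x <= 1); first by exists k.
  have pn0 : (0 < p ^ n)%N by rewrite expn_gt0 prime_gt0.
  by exists (Ordinal pn0).
exists rho; split=> [x y /rhoP rx /rhoP ry|k]; last first.
  by apply: Qp_ord_eq; rewrite absfBC; apply: rhoP; exact: Qp_abs_nat_le1.
split=> [e|xy].
  rewrite -[x - y](subrKA (rho x)%:R); apply: (le_trans (absfD abs _ _)).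
  by rewrite ge_max rx e absfBC.
apply: Qp_ord_eq.
have -> : (rho x)%:R - (rho y)%:R = (x - y) + ((y - (rho y)%:R) - (x - (rho x)%:R)) by ring.
apply: (le_trans (absfD abs _ _)); rewrite ge_max xy.
by apply: (le_trans (absfB abs _ _)); rewrite ge_max ry rx.
Qed.

End ResidueClass.

(** * The Cayley transform and the chordal distance *)

Lemma cayley_sub (F : fieldType) (y z s : F) : y - s != 0 -> z - s != 0 ->
  (y + s) / (y - s) - (z + s) / (z - s) =
  2%:R * s * (z - y) / ((y - s) * (z - s)).
Proof. by move=> y0 z0; field; rewrite y0 z0. Qed.

Lemma cayley_sub1 (F : fieldType) (y s : F) : y - s != 0 ->
  (y + s) / (y - s) - 1 = 2%:R * s / (y - s).
Proof. by move=> y0; field. Qed.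

(** With c = p, it matches the coordinate 1/(p y) near infinity with the chordal distance |y - z| /
    (|y| |z|) of large points. *)
Lemma inv_sub_inv (F : fieldType) (c y z : F) : c != 0 -> y != 0 -> z != 0 ->
  c * ((c * y)^-1 - (c * z)^-1) = - ((y - z) / (y * z)).
Proof. by move=> c0 y0 z0; field; rewrite c0 y0 z0. Qed.

Section CayleyTransform.
Variables (p : nat) (pr_p : prime p) (p_ge3 : (3 <= p)%N).
Local Notation Q := (Qp pr_p).
Local Notation abs := (Qp_abs pr_p).
Local Notation q := ((p%:R : rat)^-1).
Variables (R : realFieldType) (K : fieldType) (j : {rmorphism Q -> K}).
Variables (w : absval R K) (s : K) (D : Q).
Hypotheses (wj : forall x, w (j x) = ratr (abs x)) (sD : s ^+ 2 = j D).
Hypotheses (D_unit : abs D = 1) (D_nonsquare : forall x, x ^+ 2 <> D).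

Let p_gt0 : 0 < (p%:R : rat). Proof. by rewrite ltr0n prime_gt0. Qed.
Let p_gt1 : 1 < (p%:R : rat). Proof. by rewrite ltr1n prime_gt1. Qed.
Let q_gt0 : 0 < q. Proof. by rewrite invr_gt0. Qed.
Let q_lt1 : q < 1. Proof. by rewrite invf_lt1. Qed.

Definition cayley (y : option Q) : K :=
  if y is Some y then (j y + s) / (j y - s) else 1.

Lemma absK_sqrt : w s = 1.
Proof.
have := congr1 w sD; rewrite wj D_unit rmorph1 expr2 absfM -expr2 => /eqP.
rewrite sqrf_eq1 => /orP[/eqP//|/eqP sN].
by have := absf_ge0 w s; rewrite sN oppr_ge0 ler10.
Qed.

(** For |y| > 1 the unit [s] is negligible. For |y| at most 1 neither factor exceeds 1, and their
    product y^2 - D is a unit: otherwise Hensel's lemma would make [D] a square. *)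
Lemma absK_norm_form y : w (j y + s) = ratr (Num.max 1 (abs y)) /\
  w (j y - s) = ratr (Num.max 1 (abs y)).
Proof.
have [y1|y1] := leP (abs y) 1; last first.
  have wy : 1 < w (j y) by rewrite wj -(rmorph1 (@ratr R)) ltr_rat.
  rewrite -wj; split; apply: absf_eqr.
    by rewrite addrC addrA addNr add0r absK_sqrt.
  by rewrite addrC addrA addNr add0r absfN absK_sqrt.
have wy : w (j y) <= 1 by rewrite wj -(rmorph1 (@ratr R)) ler_rat.
have wa : w (j y + s) <= 1 by rewrite (le_trans (absfD _ _ _)) // ge_max wy absK_sqrt lexx.
have wb : w (j y - s) <= 1 by rewrite (le_trans (absfB _ _ _)) // ge_max wy absK_sqrt lexx.
have ab : w (j y + s) * w (j y - s) = 1.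
  rewrite -absfM (_ : _ * _ = j (y ^+ 2 - D)); last first.
    by rewrite mulrC -subr_sqr sD rmorphB rmorphXn.
  rewrite wj; have -> : abs (y ^+ 2 - D) = 1; last by rewrite rmorph1.
  apply: le_anti; apply/andP; split.
    apply: (le_trans (absfB abs _ _)).
    by rewrite ge_max D_unit lexx andbT expr2 absfM mulr_ile1 ?absf_ge0.
  rewrite leNgt; apply/negP => /(Qp_hensel_sqrt p_ge3 D_unit)[x].
  exact: D_nonsquare.
rewrite rmorph1; split; apply: le_anti; rewrite ?wa ?wb /= -ab.
  by rewrite ler_piMr ?absf_ge0.
by rewrite ler_piMl ?absf_ge0.
Qed.

Lemma max1_abs_gt0 y : 0 < Num.max 1 (abs y).
Proof. by rewrite lt_max ltr01. Qed.

Lemma cayley_den_neq0 y : j y - s != 0.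
Proof.
have [_ h] := absK_norm_form y.
by rewrite -(absf_eq0 w) h gt_eqF // ltr0q max1_abs_gt0.
Qed.

Lemma absK_cayley y : w (cayley y) = 1.
Proof.
case: y => [y|]; last exact: absf1.
have [h1 h2] := absK_norm_form y.
by rewrite absfM absfV h1 h2 divff // gt_eqF // ltr0q max1_abs_gt0.
Qed.

Let w2s : w (2%:R * s) = 1.
Proof.
rewrite absfM absK_sqrt mulr1 -(rmorph_nat j) wj Qp_abs_natN ?rmorph1 //.
by apply/negP => /dvdn_leq; lia.
Qed.

Lemma absK_cayley_sub y z : w (cayley (Some y) - cayley (Some z)) =
  ratr (abs (y - z) / (Num.max 1 (abs y) * Num.max 1 (abs z))).
Proof.
rewrite /cayley cayley_sub ?cayley_den_neq0 // absfM absfV.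
rewrite absfM w2s mul1r absfBC -rmorphB wj absfM.
have [_ ->] := absK_norm_form y; have [_ ->] := absK_norm_form z.
by rewrite -rmorphM -fmorph_div.
Qed.

Lemma absK_cayley_sub1 y :
  w (cayley (Some y) - cayley None) = ratr (Num.max 1 (abs y))^-1.
Proof.
rewrite /cayley cayley_sub1 ?cayley_den_neq0 // absfM w2s mul1r absfV.
have [_ ->] := absK_norm_form y.
by rewrite fmorphV.
Qed.

Lemma cayley_inj : injective cayley.
Proof.
have h y : cayley (Some y) != cayley None.
  rewrite -subr_eq0 -(absf_eq0 w) absK_cayley_sub1 gt_eqF //.
  by rewrite ltr0q invr_gt0 max1_abs_gt0.
move=> [y|] [z|] // /eqP; [|by rewrite (negbTE (h y))|by rewrite eq_sym (negbTE (h z))].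
rewrite -subr_eq0 -(absf_eq0 w) absK_cayley_sub fmorph_eq0 mulf_eq0 absf_eq0.
rewrite invr_eq0 mulf_eq0 !(gt_eqF (max1_abs_gt0 _)) !orbF subr_eq0.
by move/eqP->.
Qed.

Lemma ratr_expV n : (p%:R : R)^-1 ^+ n = ratr (q ^+ n).
Proof. by rewrite rmorphXn fmorphV rmorph_nat. Qed.

Lemma Qp_abs_gt1 (y : Q) : 1 < abs y -> p%:R <= abs y.
Proof.
move=> y1; have y0 : abs y != 0 by rewrite gt_eqF // (lt_trans ltr01).
have : abs y^-1 <= q.
  by apply: Qp_abs_lt1; rewrite absfV invf_lt1 // (lt_trans ltr01).
by rewrite absfV lef_pV2 // posrE (lt_trans ltr01).
Qed.

(* The residue discs of the projective line: [inl] is the class of y modulo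
   p^m for integral y, [inr] the class of 1/(p y) modulo p^(m-1) otherwise. *)
Lemma cayley_classes m : exists pi : option Q -> 'I_(p ^ m.+1) + 'I_(p ^ m),
  (forall t, exists y, pi y = t) /\
  forall y z, pi y = pi z <-> w (cayley y - cayley z) <= p%:R^-1 ^+ m.+1.
Proof.
have [rho [rhoE rhoK]] := Qp_residue_class pr_p m.+1.
have [rho' [rhoE' rhoK']] := Qp_residue_class pr_p m.
pose g (y : option Q) := if y is Some y then (p%:R * y)^-1 else 0.
pose int (y : option Q) := if y is Some y then abs y <= 1 else false.
pose pi y := if int y then inl (rho (odflt 0 y)) else inr (rho' (g y)).
(* A non-integral y has |y| at least p, so 1/(p y) is integral; infinity gets the coordinate 0. *)
have g1 y : ~~ int y -> abs (g y) <= 1.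
  case: y => [y|_]; last by rewrite [g _]/(0 : Q) absf0.
  rewrite [int _]/(abs y <= 1) [g _]/((p%:R * y)^-1) -ltNge => /Qp_abs_gt1 yp.
  have qy : 1 <= q * abs y by rewrite mulrC ler_pdivlMr ?mul1r.
  by rewrite absfV absfM Qp_abs_p invf_le1 // (lt_le_trans ltr01).
have p0 : (p%:R : Q) != 0 by rewrite -(absf_eq0 abs) Qp_abs_p gt_eqF.
have intd (y z : Q) : abs y <= 1 -> abs z <= 1 ->
    w (cayley (Some y) - cayley (Some z)) = ratr (abs (y - z)).
  by move=> y1 z1; rewrite absK_cayley_sub (max_l y1) (max_l z1) mulr1 divr1.
have outd y z : ~~ int y -> ~~ int z ->
    w (cayley y - cayley z) = ratr (q * abs (g y - g z)).
  have gd (y' : Q) : 1 < abs y' -> w (cayley (Some y') - cayley None) = ratr (q * abs (p%:R * y')^-1).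
    move=> y1; rewrite absK_cayley_sub1 (max_r (ltW y1)) absfV absfM Qp_abs_p.
    by rewrite invfM invrK mulrA mulVf ?mul1r // gt_eqF.
  have nint (x : Q) : ~~ int (Some x) -> 1 < abs x by rewrite ltNge.
  case: y z => [y|] [z|]; rewrite ?[g None]/(0 : Q).
  - move=> /nint y1 /nint z1; rewrite absK_cayley_sub (max_r (ltW y1)) (max_r (ltW z1)).
    have y0 : y != 0 by rewrite -(absf_eq0 abs) gt_eqF // (lt_trans ltr01).
    have z0 : z != 0 by rewrite -(absf_eq0 abs) gt_eqF // (lt_trans ltr01).
    rewrite -Qp_abs_p -!absfM -absfV -absfM; congr ratr.
    rewrite [g _]/((p%:R * y)^-1) [g (Some z)]/((p%:R * z)^-1).
    by rewrite inv_sub_inv // absfN.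
  - by move=> /nint y1 _; rewrite subr0; exact: gd.
  - by move=> _ /nint z1; rewrite sub0r absfN absfBC; exact: gd.
  - by rewrite !subrr !absf0 mulr0 rmorph0.
(* Integral and non-integral points are at maximal distance, so they never share a disc. *)
have mixd y z : int y -> ~~ int z -> w (cayley y - cayley z) = 1.
  case: y z => [y|] // [z|] y1 z1; last first.
    by rewrite absK_cayley_sub1 (max_l y1) invr1 rmorph1.
  have {}z1 : 1 < abs z by rewrite ltNge.
  rewrite absK_cayley_sub (max_l y1) (max_r (ltW z1)) mul1r.
  have -> : abs (y - z) = abs z.
    rewrite absfBC; apply: absf_eqr.
    by rewrite addrAC subrr add0r absfN; exact: le_lt_trans z1.
  by rewrite divff ?rmorph1 // gt_eqF // (lt_trans ltr01).
have ql1 : (p%:R^-1 ^+ m.+1 : R) < 1.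
  by rewrite ratr_expV -(rmorph1 (@ratr R)) ltr_rat exprn_ilt1 // ltW.
exists pi; split.
  move=> [k|k].
    exists (Some k%:R); rewrite /pi (_ : int _ = true) ?rhoK //; exact: Qp_abs_nat_le1.
  (* The coordinate 0 near infinity is attained at the point at infinity only. *)
  have [k0|k0] := eqVneq (k%:R : Q) 0.
    exists None; have -> : pi None = inr (rho' 0) by [].
    by rewrite -k0 rhoK'.
  exists (Some (p%:R * k%:R)^-1).
  have ni : ~~ int (Some (p%:R * k%:R)^-1).
    suff: 1 < abs (p%:R * k%:R)^-1 by rewrite ltNge.
    rewrite absfV invf_gt1 ?absf_gt0 ?mulf_neq0 //.
    rewrite absfM Qp_abs_p; apply: le_lt_trans q_lt1.
    by rewrite ler_piMr ?Qp_abs_nat_le1 // ltW.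
  by rewrite /pi (negbTE ni) /g invfM invrK mulrA mulVf // mul1r rhoK'.
move=> y z; rewrite /pi; case: (boolP (int y)) => iy; case: (boolP (int z)) => iz.
- case: y z iy iz => [y|] // [z|] // iy iz; rewrite intd // ratr_expV ler_rat.
  by split=> [[/(rhoE _ _ iy iz)]|/(rhoE _ _ iy iz)->].
- by split=> //; rewrite mixd // leNgt ql1.
- by split=> //; rewrite absfBC mixd // leNgt ql1.
- rewrite outd // ratr_expV ler_rat exprS ler_pM2l //.
  by split=> [[/(rhoE' _ _ (g1 _ iy) (g1 _ iz))]|/(rhoE' _ _ (g1 _ iy) (g1 _ iz))->].
Qed.

End CayleyTransform.

(** * Linearisation of a homography at its two fixed points *)

Lemma cayley_homography_step (F : fieldType) (a b c d x S : F) :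
  S ^+ 2 = (d - a) ^+ 2 + 4%:R * b * c -> 2%:R != 0 :> F -> c * x + d != 0 ->
  (2%:R * c * ((a * x + b) / (c * x + d)) + (d - a) + S) /
    (2%:R * c * ((a * x + b) / (c * x + d)) + (d - a) - S) =
  (a + d + S) / (a + d - S) *
    ((2%:R * c * x + (d - a) + S) / (2%:R * c * x + (d - a) - S)).
Proof.
move=> S2 t0 x0; rewrite [RHS]mulf_div.
(* One identity, valid for both square roots, serves the numerator with [S] and the denominator with
   [- S]; the common factor [2%:R * (c * x + d)] then cancels. *)
have e S' : S' ^+ 2 = S ^+ 2 -> (a + d + S') * (2%:R * c * x + (d - a) + S') =
    2%:R * (c * x + d) *
      (2%:R * c * ((a * x + b) / (c * x + d)) + (d - a) + S').
  move=> S2'; transitivity ((a + d) * (2%:R * c * x + (d - a)) + S' ^+ 2 +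
    S' * (2%:R * (c * x + d))); first by ring.
  by rewrite S2' S2; field.
rewrite e // (e (- S)) ?sqrrN // -mulf_div divff ?mul1r //.
by rewrite mulf_neq0.
Qed.

(** The numerator and denominator of the product differ by [4%:R * S * (c * x + d)], which vanishes
    at the pole. *)
Lemma cayley_homography_pole (F : fieldType) (a b c d x S : F) :
  S ^+ 2 = (d - a) ^+ 2 + 4%:R * b * c -> c * x + d = 0 ->
  a + d - S != 0 -> 2%:R * c * x + (d - a) - S != 0 ->
  (a + d + S) / (a + d - S) *
    ((2%:R * c * x + (d - a) + S) / (2%:R * c * x + (d - a) - S)) = 1.
Proof.
move=> S2 x0 h1 h2; rewrite mulf_div.
have -> : (a + d + S) * (2%:R * c * x + (d - a) + S) =
    (a + d - S) * (2%:R * c * x + (d - a) - S) + 4%:R * S * (c * x + d) by ring.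
by rewrite x0 mulr0 addr0 divff // mulf_neq0.
Qed.

Section HomographyMultiplier.
Variables (F K : fieldType) (j : {rmorphism F -> K}) (a b c d Delta : F) (S : K).
Hypotheses (DeltaE : Delta = (d - a) ^+ 2 + 4%:R * b * c).
Hypotheses (Delta_nsq : forall x, x ^+ 2 <> Delta) (S2 : S ^+ 2 = j Delta).
Hypothesis (two_neq0 : 2%:R != 0 :> F).

(** This is chi: the ratio of the differences between x and the fixed points (a - d - S) / 2c and (a
    - d + S) / 2c of the homography. *)
Definition fixpoint_ratio (x : option F) : K :=
  if x is Some x then
    (j (2%:R * c * x + (d - a)) + S) / (j (2%:R * c * x + (d - a)) - S)
  else 1.

Lemma sub_sqrt_neq0 u : j u - S != 0.
Proof.
rewrite subr_eq0; apply/eqP => uS; apply: (@Delta_nsq u).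
by apply: (fmorph_inj j); rewrite -S2 -uS rmorphXn.
Qed.

Lemma lower_left_neq0 : c != 0.
Proof.
apply/eqP => c0; apply: (@Delta_nsq (d - a)).
by rewrite DeltaE c0 mulr0 addr0.
Qed.

(** A coordinate sending the two fixed points to 0 and infinity turns the homography into a
    multiplication. The multiplier is read off at infinity, whose image is a / c; the pole is
    treated apart. *)
Lemma fixpoint_ratio_homography x : fixpoint_ratio (homography a b c d x) =
  (j (a + d) + S) / (j (a + d) - S) * fixpoint_ratio x.
Proof.
have c0 := lower_left_neq0.
have S2' : S ^+ 2 = (j d - j a) ^+ 2 + 4%:R * j b * j c.
  by rewrite S2 DeltaE rmorphD rmorphXn rmorphB !rmorphM rmorph_nat.
have jE y : j (2%:R * c * y + (d - a)) = 2%:R * j c * j y + (j d - j a).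
  by rewrite rmorphD !rmorphM rmorph_nat rmorphB.
case: x => [x|]; rewrite /homography /fixpoint_ratio; last first.
  rewrite (negbTE c0) mulr1.
  have -> : 2%:R * c * (a / c) + (d - a) = a + d; last by [].
  by field.
have [x0|x0] := eqVneq (c * x + d) 0.
  rewrite jE rmorphD (cayley_homography_pole S2') // -?rmorphD; first by rewrite -rmorphM -rmorphD x0 rmorph0.
    exact: sub_sqrt_neq0.
  by rewrite -jE sub_sqrt_neq0.
rewrite !jE rmorphD fmorph_div !rmorphD !rmorphM (cayley_homography_step S2') //.
  by rewrite -(rmorph_nat j) fmorph_eq0.
by rewrite -rmorphM -rmorphD fmorph_eq0.
Qed.

End HomographyMultiplier.

(** * Dynamics of the homography on residue discs *)

Lemma affine_sub (F : fieldType) (u v r x y : F) :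
  (u * x + v) / r - (u * y + v) / r = u / r * (x - y).
Proof. by rewrite -mulrBl opprD addrACA subrr addr0 -mulrBr mulrAC. Qed.

Lemma affineK (F : fieldType) (u v r y : F) : u != 0 -> r != 0 ->
  (u * ((r * y - v) / u) + v) / r = y.
Proof. by move=> u0 r0; field; rewrite u0 r0. Qed.

Section HomographyDynamics.
Variables (p : nat) (pr_p : prime p) (p_ge3 : (3 <= p)%N).
Local Notation Q := (Qp pr_p).
Local Notation abs := (Qp_abs pr_p).
Variables (R : realType) (K : fieldType) (j : {rmorphism Q -> K}).
Variables (w : absval R K) (a b c d Delta r : Q) (S : K).
Hypotheses (wj : forall x, w (j x) = ratr (abs x)).
Hypotheses (DeltaE : Delta = (d - a) ^+ 2 + 4%:R * b * c).
Hypotheses (Delta_nsq : forall x, x ^+ 2 <> Delta) (S2 : S ^+ 2 = j Delta).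
Hypotheses (r_neq0 : r != 0) (wS : w S = w (j r)).
Local Notation f := (homography a b c d).
Local Notation s := (S / j r).
Local Notation chi := (fixpoint_ratio j a c d S).
Local Notation lambda := ((j (a + d) + S) / (j (a + d) - S)).

Let jr_neq0 : j r != 0. Proof. by rewrite fmorph_eq0. Qed.

Let two_neq0 : (2%:R : Q) != 0.
Proof.
rewrite -(absf_eq0 abs) Qp_abs_natN ?oner_eq0 //.
by apply/negP => /dvdn_leq; lia.
Qed.

(** Division by [r], which has the size of [S], replaces the square root [S] by the unit [S / j r],
    so that chi becomes a Cayley transform. *)
Definition normal_coordinate (x : option Q) : option Q :=
  omap (fun x => (2%:R * c * x + (d - a)) / r) x.
Local Notation psi := normal_coordinate.

Let s2 : s ^+ 2 = j (Delta / r ^+ 2).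
Proof. by rewrite expr_div_n S2 fmorph_div rmorphXn. Qed.

Let D_unit : abs (Delta / r ^+ 2) = 1.
Proof.
have w1 : w (j (Delta / r ^+ 2)) = 1.
  by rewrite -s2 expr2 absfM absfM absfV wS divff ?mulr1 // absf_eq0.
by move/eqP: w1; rewrite wj fmorph_eq1 => /eqP.
Qed.

Let D_nsq x : x ^+ 2 <> Delta / r ^+ 2.
Proof.
move=> xD; apply: (@Delta_nsq (x * r)).
by rewrite exprMn xD divfK // expf_neq0.
Qed.

Let two_c_neq0 : 2%:R * c != 0.
Proof. by rewrite mulf_neq0 // (lower_left_neq0 DeltaE Delta_nsq). Qed.

Lemma cayley_scale u : (j (u / r) + s) / (j (u / r) - s) = (j u + S) / (j u - S).
Proof.
by rewrite fmorph_div -mulrBl -mulrDl -mulf_div divff ?mulr1 // invr_neq0.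
Qed.

Lemma cayley_normal_coordinate x : cayley j s (psi x) = chi x.
Proof. by case: x => [x|] //; exact: cayley_scale. Qed.

Lemma normal_coordinate_surj y : exists x, psi x = y.
Proof.
case: y => [y|]; last by exists None.
exists (Some ((r * y - (d - a)) / (2%:R * c))).
by rewrite /psi /omap /obind /oapp affineK.
Qed.

(** The multiplier is itself a value of the Cayley transform, at (a + d) / r. *)
Lemma absK_multiplier : w lambda = 1.
Proof.
by rewrite -cayley_scale; exact: (absK_cayley p_ge3 wj s2 D_unit D_nsq (Some _)).
Qed.

Lemma absK_fixpoint_ratio x : w (chi x) = 1.
Proof.
by rewrite -cayley_normal_coordinate; exact: (absK_cayley p_ge3 wj s2 D_unit D_nsq).
Qed.

Lemma fixpoint_ratio_inj : injective chi.
Proof.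
move=> x y; rewrite -!cayley_normal_coordinate.
move/(cayley_inj p_ge3 wj s2 D_unit D_nsq).
case: x y => [x|] [y|] //= [] /(mulIf (invr_neq0 r_neq0)) /addIr.
by move/(mulfI two_c_neq0) ->.
Qed.

Lemma fixpoint_ratio_iter n x : chi (iter n f x) = lambda ^+ n * chi x.
Proof.
elim: n => [|n IHn]; first by rewrite mul1r.
by rewrite iterS (fixpoint_ratio_homography DeltaE Delta_nsq S2) // IHn exprS mulrA.
Qed.

(** The displacement does not depend on the point, so all discs of a given radius have the same
    period. *)
Lemma absK_iter_sub n x : w (chi (iter n f x) - chi x) = w (lambda ^+ n - 1).
Proof.
rewrite fixpoint_ratio_iter -[X in _ - X]mul1r -mulrBl absfM.
by rewrite absK_fixpoint_ratio mulr1.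
Qed.

Let ratr_exp n : (p%:R : R)^-1 ^+ n = ratr ((p%:R : rat)^-1 ^+ n).
Proof. by rewrite rmorphXn fmorphV rmorph_nat. Qed.

Let p_gt0 : 0 < (p%:R : rat). Proof. by rewrite ltr0n prime_gt0. Qed.

Lemma fixpoint_ratio_nbhs (x : P1 pr_p) n :
  nbhs x [set y | w (chi y - chi x) <= p%:R^-1 ^+ n].
Proof.
have k_gt0 : 0 < abs (2%:R * c / r).
  by rewrite absf_gt0 mulf_neq0 ?invr_neq0.
have qn_gt0 : 0 < (p%:R : rat)^-1 ^+ n by rewrite exprn_gt0 ?invr_gt0.
have m1 (y : Q) := max1_abs_gt0 y.
case: x => [x|].
  apply/Qp_nbhsP; exists (p%:R^-1 ^+ n / abs (2%:R * c / r)); first exact: divr_gt0.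
  move=> y; rewrite ltr_pdivlMr // => yx.
  change (w (chi (Some y) - chi (Some x)) <= p%:R^-1 ^+ n).
  rewrite -!cayley_normal_coordinate (absK_cayley_sub p_ge3 wj s2 D_unit D_nsq).
  rewrite ratr_exp ler_rat ler_pdivrMr ?mulr_gt0 // affine_sub absfM absfBC mulrC.
  apply: (le_trans (ltW yx)); rewrite ler_pMr //.
  by rewrite -[X in X <= _]mulr1 ler_pM // le_max lexx.
(* Beyond [m], the term 2cx/r dominates the translation (d - a)/r and the distance to infinity is at
   most p^-n; |x| > p^C guarantees this. *)
pose m := Num.max (p%:R ^+ n) (abs ((d - a) / r)).
have m_gt0 : 0 < m by rewrite lt_max exprn_gt0.
have [C mC] := inv_prime_exp_lt pr_p (divr_gt0 k_gt0 m_gt0).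
apply: filterS (P1_nbhs_infty pr_p C) => -[x xC|_]; last first.
  by rewrite /= subrr absf0 exprn_ge0 // invr_ge0 ler0n.
change (w (chi (Some x) - chi None) <= p%:R^-1 ^+ n).
have mx : m < abs (2%:R * c / r * x).
  rewrite absfM -ltr_pdivrMl //; apply: lt_trans xC.
  by rewrite ltr_pdivrMl // -ltr_pdivrMr ?exprn_gt0 // -exprVn mulrC -ltr_pdivlMr.
have yE : abs ((2%:R * c * x + (d - a)) / r) = abs (2%:R * c / r * x).
  apply: absf_eqr; rewrite mulrDl mulrAC addrC addrA addNr add0r.
  by apply: le_lt_trans mx; rewrite le_max lexx orbT.
rewrite -!cayley_normal_coordinate (absK_cayley_sub1 p_ge3 wj s2 D_unit D_nsq).
rewrite ratr_exp ler_rat exprVn lef_pV2 ?posrE ?exprn_gt0 // le_max yE orbC.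
by apply/orP; left; apply: le_trans (ltW mx); rewrite le_max lexx.
Qed.

Lemma fixpoint_ratio_classes m :
  exists pi : P1 pr_p -> 'I_(p ^ m.+1) + 'I_(p ^ m),
  (forall t, exists x, pi x = t) /\
  forall x y, pi x = pi y <-> w (chi x - chi y) <= p%:R^-1 ^+ m.+1.
Proof.
have [pi [pi_onto piE]] := cayley_classes p_ge3 wj s2 D_unit D_nsq m.
exists (pi \o psi); split=> [t|x y].
  have [y <-] := pi_onto t; have [x <-] := normal_coordinate_surj y.
  by exists x.
by rewrite -!cayley_normal_coordinate; exact: piE.
Qed.

Variables (l v : nat).
Hypothesis l_order : l.-primitive_root (reduction w lambda).
Hypothesis v_val : w (lambda ^+ l - 1) = p%:R^-1 ^+ v.+1.

Let q_gt0 : 0 < (p%:R : R)^-1. Proof. by rewrite invr_gt0 ltr0n prime_gt0. Qed.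
Let q_lt1 : (p%:R : R)^-1 < 1.
Proof. by rewrite invf_lt1 ?ltr1n ?prime_gt1 // ltr0n prime_gt0. Qed.

Let wp : w p%:R = p%:R^-1.
Proof. by rewrite -(rmorph_nat j) wj Qp_abs_p fmorphV rmorph_nat. Qed.

Let l_dvd n : (w (lambda ^+ n - 1) < 1) = (l %| n)%N.
Proof. by apply: primitive_reduction_dvd l_order; rewrite absK_multiplier. Qed.

(** If l does not divide n, the power is not 1 in the residue field and the left side is at least 1;
    otherwise the exponent is lifted from [lambda ^+ l]. *)
Lemma multiplier_period k n :
  (w (lambda ^+ n - 1) <= p%:R^-1 ^+ (v.+1 + k)) = (l * p ^ k %| n)%N.
Proof.
have [/dvdnP[n' ->]|ln] := boolP (l %| n)%N.
  rewrite mulnC exprM (absf_expB1_le_dvd pr_p p_ge3 wp _ _ _ v_val) //.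
  by rewrite dvdn_pmul2l // (prim_order_gt0 l_order).
rewrite [RHS](contraNF _ ln) => [|/(dvdn_trans (dvdn_mulr _ (dvdnn l)))//].
apply/negbTE; rewrite -ltNge; apply: (@lt_le_trans _ _ 1); first by rewrite exprn_ilt1 // ltW.
by rewrite leNgt l_dvd.
Qed.

Lemma order_dvd_succ : (l %| p.+1)%N.
Proof.
have [pi [pi_onto piE]] := fixpoint_ratio_classes 0.
have [||M [card _]] := @orbit_representatives _ f _ pi l pi_onto _ (prim_order_gt0 l_order).
- move=> x y /piE xy; apply/piE.
  rewrite -[f x]/(iter 1 f x) -[f y]/(iter 1 f y) !fixpoint_ratio_iter.
  by rewrite -mulrBr absfM absfX absK_multiplier expr1n mul1r.
(* The passage from < 1 to at most 1/p goes through the power [lambda ^+ l], whose distance to 1 is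
   a positive power of 1/p by [v_val]. *)
- move=> n x; rewrite piE absK_iter_sub -l_dvd expr1; split=> [/le_lt_trans->//|].
  rewrite l_dvd => /dvdnP[n' ->]; rewrite mulnC exprM.
  have x1 : w (lambda ^+ l - 1) <= p%:R^-1.
    by rewrite v_val -[X in _ <= X]expr1 ler_iXn2l.
  by apply: (le_trans _ x1); apply: absf_expB1_le; exact: le_lt_trans x1 q_lt1.
move: card; rewrite card_sum !card_ord expn1 expn0 addn1 => ->.
exact: dvdn_mull.
Qed.

Theorem homography_odometer_decomposition :
  exists E : 'I_(p.+1 %/ l * p ^ v) -> set (P1 pr_p),
    minimal_decomposition f E /\
    forall i, topologically_conjugate f (E i)
      (adding_machine (fun s => l * p ^ s)%N)
      (odometer (fun s => l * p ^ s)%N).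
Proof.
have l_gt0 := prim_order_gt0 l_order.
(* Here [v] is the valuation of [lambda ^+ l - 1] minus one: level k consists of the discs of radius
   p^-(v+1+k), and at level 0 the orbits have length l. *)
pose X k : finType := ('I_(p ^ (v + k).+1) + 'I_(p ^ (v + k)))%type.
pose pi k : P1 pr_p -> X k := projT1 (cid (fixpoint_ratio_classes (v + k))).
have pi_onto k t : exists x, pi k x = t.
  by have [+ _] := projT2 (cid (fixpoint_ratio_classes (v + k))); apply.
have piE k x y : pi k x = pi k y <-> w (chi x - chi y) <= p%:R^-1 ^+ (v.+1 + k).
  by have [_ +] := projT2 (cid (fixpoint_ratio_classes (v + k))); apply.
apply: (@odometer_decomposition _ f X pi (fun k => l * p ^ k)%N).
- exact: one_point_compactification_compact.
- exact: pi_onto.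
- move=> k x; apply: filterS (fixpoint_ratio_nbhs x (v.+1 + k)) => y /= yx.
  exact/piE.
- move=> k x y /piE xy; apply/piE; apply: (le_trans xy).
  by rewrite ler_iXn2l // addnS.
- move=> x y xy; apply: fixpoint_ratio_inj; apply/eqP.
  rewrite -subr_eq0 -(absf_eq0 w) -[_ == 0]negbK; apply/negP => h.
  have /(inv_prime_exp_lt pr_p)[n] : 0 < w (chi x - chi y).
    by rewrite lt_neqAle eq_sym h absf_ge0.
  rewrite ltNge => /negP; apply; apply: (le_trans (proj1 (piE n x y) (xy n))).
  by rewrite ler_iXn2l // leq_addl.
- move=> k x y /piE xy; apply/piE.
  rewrite -[f x]/(iter 1 f x) -[f y]/(iter 1 f y) !fixpoint_ratio_iter.
  by rewrite -mulrBr absfM absfX absK_multiplier expr1n mul1r.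
- by move=> k; rewrite muln_gt0 l_gt0 expn_gt0 prime_gt0.
- by move=> k n x; rewrite piE absK_iter_sub multiplier_period.
(* The (p + 1) p^(v+k) discs form (p + 1) p^v / l orbits of length l p^k, a number independent of
   k. *)
- move=> k; rewrite card_sum !card_ord mulnACA divnK ?order_dvd_succ //.
  by rewrite -expnD expnS mulSn addnC.
Qed.

End HomographyDynamics.

(** * Normalisation in the unramified extension and the final count *)

Theorem theorem5p3 (p : nat) (pr_p : prime p) (p_ge3 : (3 <= p)%N)
    (a b c d : Qp pr_p) (det_neq0 : a * d - b * c != 0)
    (Delta : Qp pr_p) (DeltaE : Delta = (d - a) ^+ 2 + 4%:R * b * c)
    (Delta_nsq : ~ exists x : Qp pr_p, x ^+ 2 = Delta)
    (K : fieldExtType (Qp pr_p)) (sqrtDelta : K)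
    (sqrtDeltaE : sqrtDelta ^+ 2 = Delta%:A)
    (K_gen : <<1; sqrtDelta>>%VS = fullv)
    (R : realType) (absK : absval R K) (absKE : abs_extends absK)
    (lambda : K)
    (lambdaE : lambda = ((a + d)%:A + sqrtDelta) / ((a + d)%:A - sqrtDelta))
    (lambda_not_root1 : forall n : nat, (0 < n)%N -> lambda ^+ n <> 1)
    (l : nat) (l_order : l.-primitive_root (reduction absK lambda))
    (K_quadratic : \dim {:K} = 2%N) (K_unramified : unramified absK) :
  (l %| p.+1)%N /\
  exists (M : nat) (E : 'I_M -> set (P1 pr_p)),
    [/\ M%:R = p.+1%:R * p%:R `^ (vp p absK (lambda ^+ l - 1) - 1) / l%:R :> R,
        minimal_decomposition (homography a b c d) E
      & forall i : 'I_M,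
          topologically_conjugate (homography a b c d) (E i)
            (adding_machine (fun s => l * p ^ s)%N)
            (odometer (fun s => l * p ^ s)%N)].
Proof.
pose j : {rmorphism Qp pr_p -> K} := GRing.in_alg K.
have wj x : absK (j x) = ratr (Qp_abs pr_p x) := absKE x.
have nsq x : x ^+ 2 <> Delta by move=> xD; apply: Delta_nsq; exists x.
have S2 : sqrtDelta ^+ 2 = j Delta by [].
have S0 : sqrtDelta != 0.
  apply/eqP => S0; apply: (nsq 0); apply: (fmorph_inj j).
  by rewrite -S2 S0 rmorphXn rmorph0.
(* Ramification index 1 provides the scalar [r] that makes the square root a unit. *)
have [r r0 wS] := K_unramified _ S0.
have lE : lambda = (j (a + d) + sqrtDelta) / (j (a + d) - sqrtDelta) by [].
rewrite lE in lambda_not_root1 l_order *.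
have l_gt0 := prim_order_gt0 l_order.
have w1 := absK_multiplier p_ge3 a d wj nsq S2 r0 wS.
set mu := _ / _ in lambda_not_root1 l_order w1 *.
have lt1 : absK (mu ^+ l - 1) < 1.
  by rewrite (primitive_reduction_dvd _ _ l_order) ?w1.
have mu0 : mu ^+ l - 1 != 0 by rewrite subr_eq0; apply/eqP; exact: lambda_not_root1.
have p_gt1 : 1 < (p%:R : R) by rewrite ltr1n prime_gt1.
have p_gt0 : 0 < (p%:R : R) by rewrite ltr0n prime_gt0.
(* This value is nonzero, lies in p^Z by unramifiedness and is below 1, so its exponent is some
   [Negz v], that is -(v + 1). *)
have [v wv] : exists v, absK (mu ^+ l - 1) = p%:R^-1 ^+ v.+1.
  have [x x0 wx] := K_unramified _ mu0.
  have [k xk] := Qp_abs_value x0.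
  have wk : absK (mu ^+ l - 1) = p%:R ^ k.
    by rewrite wx absKE xk rmorphXz ?rmorph_nat // unitfE gt_eqF // ltr0n prime_gt0.
  move: lt1; rewrite wk -(expr0z (p%:R : R)) ltr_eXz2l //.
  case: k {xk wk} => // k _; exists k.
  by rewrite NegzE -exprnN exprVn.
have ldvd := order_dvd_succ p_ge3 wj DeltaE nsq S2 r0 wS l_order wv.
split; first exact: ldvd.
have [E [Edec Econj]] :=
  homography_odometer_decomposition p_ge3 wj DeltaE nsq S2 r0 wS l_order wv.
exists _, E; split=> //.
have lnp : ln (p%:R : R) != 0 by rewrite gt_eqF // ln_gt0.
(* The real exponent of the count is thus a natural number, and the real power becomes an ordinary
   one. *)
have -> : vp p absK (mu ^+ l - 1) - 1 = v%:R.
  rewrite /vp wv exprVn lnV ?posrE ?exprn_gt0 // lnXn // mulNr opprK.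
  by rewrite -[ln _ *+ _]mulr_natr mulrAC divff // mul1r -[v.+1]addn1 natrD addrK.
by rewrite powR_mulrn ?ltW // natrM natrX natf_div // mulrAC.
Qed.
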